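(* Let $K$ be a field of characteristic $0$ such that the equation $\lambda^2+\lambda+1=0$ has a solution $\epsilon$ in $K$, and let $\alpha\in K$. If $\alpha^3\neq1$, then the relations $$\varphi_{\gamma_1}\varphi_{\gamma_2}=\varphi_{\gamma_1\gamma_2}\quad(\gamma_1,\gamma_2\in K^* ),$$ $$\sigma\varphi_\gamma=\varphi_\gamma\sigma,\qquad \tau\varphi_\gamma=\varphi_\gamma\tau\quad(\gamma\in K^* ),$$ $$\sigma^3=\mathrm{id},\qquad \tau^3=\mathrm{id},\qquad \sigma\tau=\varphi_\epsilon\tau\sigma$$ are defining relations of the group $\mathrm{Aut}\,E_\alpha$ with respect to the generators $\varphi_\gamma$ ($\gamma\in K^*$), $\sigma$ and $\tau$.
   Context: For $\alpha\in K$ put $C=\frac13(x^3+y^3+z^3)-\alpha xyz\in K[x,y,z]$. The elliptic Poisson algebra $E_\alpha$ is the polynomial algebra $K[x,y,z]$ endowed with the Poisson bracket determined by $\{x,y\}=-\alpha xy+z^2$, $\{y,z\}=-\alpha yz+x^2$, $\{z,x\}=-\alpha zx+y^2$; equivalently $\{u,v\}=J(u,v,C)$ for all $u,v\in K[x,y,z]$, where $J(f_1,f_2,f_3)$ is the determinant of the Jacobian matrix of $(f_1,f_2,f_3)$ with respect to $(x,y,z)$. An automorphism of a Poisson algebra $P$ over $K$ is a bijective $K$-linear map $\phi:P\to P$ with $\phi(ab)=\phi(a)\phi(b)$ and $\phi(\{a,b\})=\{\phi(a),\phi(b)\}$ for all $a,b\in P$. $\mathrm{Aut}\,E_\alpha$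 is the group of automorphisms of $E_\alpha$ as a Poisson algebra, with product the composition $(\phi\psi)(f)=\phi(\psi(f))$. $K^*$ is the multiplicative group of $K$. The following are automorphisms of $E_\alpha$: $\varphi_\gamma$ ($\gamma\in K^*$), given by $x\mapsto\gamma x$, $y\mapsto\gamma y$, $z\mapsto\gamma z$; $\tau$, given by $x\mapsto y$, $y\mapsto z$, $z\mapsto x$; and $\sigma$, given by $x\mapsto x$, $y\mapsto\epsilon y$, $z\mapsto\epsilon^2 z$. ''Defining relations with respect to the generators'' means that $\mathrm{Aut}\,E_\alpha$ is presented, as an abstract group, by these generators and these relations. *)

(* Defs.v *)
From HB Require Import structures.
From mathcomp Require Import all_boot all_order all_algebra.
From mathcomp Require Import boolp mpoly ring.

Set Implicit Arguments.
Unset Strict Implicit.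
Unset Printing Implicit Defensive.

Import GRing.Theory.
Local Open Scope ring_scope.

Section Presentation.
Variable X : Type.

(* A letter (false, x) stands for x and (true, x) for its inverse. *)
Definition letter := (bool * X)%type.
Definition word := seq letter.

Definition inv_letter (l : letter) : letter := (~~ l.1, l.2).

(* Equality in the group < X | R >: the least congruence on the free monoid of
   words that contains free cancellation and the pairs in R. *)
Inductive presented_eq (R : word -> word -> Prop) : word -> word -> Prop :=
| PresRefl w : presented_eq R w w
| PresSym u v : presented_eq R u v -> presented_eq R v u
| PresTrans u v w :
    presented_eq R u v -> presented_eq R v w -> presented_eq R u w
| PresCat u u' v v' :
    presented_eq R u u' -> presented_eq R v v' ->
    presented_eq R (u ++ v) (u' ++ v')
| PresCancel l : presented_eq R [:: l; inv_letter l] [::]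
| PresRel u v : R u v -> presented_eq R u v.

Definition eval_word (G : groupType) (f : X -> G) (w : word) : G :=
  (\prod_(l <- w) (if l.1 then (f l.2)^-1 else f l.2))%g.

(* The f x generate G, and the kernel of the induced morphism from the free
   group on X to G is the normal closure of R, i.e. < X | R > -> G is an
   isomorphism. *)
Definition defining_relations (G : groupType) (f : X -> G)
    (R : word -> word -> Prop) : Prop :=
  (forall g : G, exists w, eval_word f w = g) /\
  (forall u v, eval_word f u = eval_word f v <-> presented_eq R u v).

End Presentation.

HB.mixin Record isPoisson (K : fieldType) P of GRing.ComAlgebra K P := {
  bracket : P -> P -> P;
  bracket_linearl : forall b, linear (bracket^~ b);
  bracket_linearr : forall a, linear (bracket a);
  bracketxx : forall a, bracket a a = 0;
  bracketMl : forall a b c,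
    bracket (a * b) c = a * bracket b c + bracket a c * b;
  bracket_jacobi : forall a b c,
    bracket a (bracket b c) + bracket b (bracket c a)
      + bracket c (bracket a b) = 0
}.

#[short(type="poissonType")]
HB.structure Definition Poisson (K : fieldType) :=
  {P of GRing.ComAlgebra K P & isPoisson K P}.

Definition poisson_aut (K : fieldType) (P : poissonType K) (f : P -> P) : Prop :=
  [/\ bijective f, linear f, {morph f : a b / a * b}
    & {morph f : a b / bracket a b}].

Record pAut (K : fieldType) (P : poissonType K) := PAut {
  paut_fun :> P -> P;
  paut_prop : `[< poisson_aut paut_fun >] }.

Section PoissonAutGroup.
Variables (K : fieldType) (P : poissonType K).

HB.instance Definition _ := [isSub for @paut_fun K P].
HB.instance Definition _ := [Choice of pAut P by <:].

Implicit Types phi psi : pAut P.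

Lemma pAutP phi : poisson_aut phi.
Proof. exact/asboolP/paut_prop. Qed.

Definition mk_pAut f (fP : poisson_aut f) : pAut P := PAut (asboolT fP).

Lemma pAut_eq phi psi : phi =1 psi -> phi = psi.
Proof. by move=> e; apply: val_inj; apply: funext. Qed.

Lemma poisson_aut_id : poisson_aut (@id P).
Proof. by split=> //; exists id. Qed.

Lemma poisson_aut_comp phi psi : poisson_aut (phi \o psi).
Proof.
have [bf lf mf pf] := pAutP phi; have [bg lg mg pg] := pAutP psi.
split; first exact: bij_comp.
- by move=> a u v /=; rewrite lg lf.
- by move=> a b /=; rewrite mg mf.
- by move=> a b /=; rewrite pg pf.
Qed.

Lemma pAut_surj phi (y : P) : exists x, phi x == y.
Proof. by have [[g _ gK] _ _ _] := pAutP phi; exists (g y); rewrite gK. Qed.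

Definition paut_inv_fun phi (y : P) : P := xchoose (pAut_surj phi y).

Lemma paut_inv_funK phi : cancel (paut_inv_fun phi) phi.
Proof. by move=> y; apply/eqP/(xchooseP (pAut_surj phi y)). Qed.

Lemma paut_funK phi : cancel phi (paut_inv_fun phi).
Proof.
have [bf _ _ _] := pAutP phi.
by move=> x; apply: (bij_inj bf); rewrite paut_inv_funK.
Qed.

Lemma poisson_aut_inv phi : poisson_aut (paut_inv_fun phi).
Proof.
have [bf lf mf pf] := pAutP phi; have fI := bij_inj bf.
split; first by exists phi; [apply: paut_inv_funK | apply: paut_funK].
- by move=> a u v; apply: fI; rewrite lf !paut_inv_funK.
- by move=> a b; apply: fI; rewrite mf !paut_inv_funK.
- by move=> a b; apply: fI; rewrite pf !paut_inv_funK.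
Qed.

Definition paut_one : pAut P := mk_pAut poisson_aut_id.
Definition paut_mul phi psi : pAut P := mk_pAut (poisson_aut_comp phi psi).
Definition paut_inv phi : pAut P := mk_pAut (poisson_aut_inv phi).

Lemma paut_mulA : associative paut_mul.
Proof. by move=> f g h; apply: pAut_eq. Qed.

Lemma paut_mul1 : left_id paut_one paut_mul.
Proof. by move=> f; apply: pAut_eq. Qed.

Lemma paut_mulr1 : right_id paut_one paut_mul.
Proof. by move=> f; apply: pAut_eq. Qed.

Lemma paut_mulV : left_inverse paut_one paut_inv paut_mul.
Proof. by move=> f; apply: pAut_eq => x /=; apply: paut_funK. Qed.

Lemma paut_mulrV : right_inverse paut_one paut_inv paut_mul.
Proof. by move=> f; apply: pAut_eq => x /=; apply: paut_inv_funK. Qed.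

HB.instance Definition _ := isGroup.Build (pAut P)
  paut_mulA paut_mul1 paut_mulr1 paut_mulV paut_mulrV.

End PoissonAutGroup.

Lemma det2 (R : comNzRingType) (A : 'M[R]_2) :
  \det A = A 0 0 * A 1 1 - A 0 1 * A 1 0.
Proof.
rewrite (expand_det_row _ 0) !big_ord_recl big_ord0 /cofactor !det_mx11 !mxE.
rewrite addr0 expr0 mul1r expr1 mulN1r mulrN.
by congr (A _ _ * A _ _ - A _ _ * A _ _); apply: val_inj.
Qed.

Lemma det3 (R : comNzRingType) (A : 'M[R]_3) :
  \det A = A 0 0 * (A 1 1 * A 2 2 - A 1 2 * A 2 1)
         - A 0 1 * (A 1 0 * A 2 2 - A 1 2 * A 2 0)
         + A 0 2 * (A 1 0 * A 2 1 - A 1 1 * A 2 0).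
Proof.
rewrite (expand_det_row _ 0) !big_ord_recl big_ord0 /cofactor !det2 !mxE.
rewrite addr0 expr0 mul1r expr1 mulN1r mulrN -signr_odd expr0 mul1r addrA.
by congr (A _ _ * (A _ _ * A _ _ - A _ _ * A _ _)
  - A _ _ * (A _ _ * A _ _ - A _ _ * A _ _)
  + A _ _ * (A _ _ * A _ _ - A _ _ * A _ _)); apply: val_inj.
Qed.

Definition d3 (R : comNzRingType) (a0 a1 a2 b0 b1 b2 c0 c1 c2 : R) : R :=
  a0 * (b1 * c2 - b2 * c1) - a1 * (b0 * c2 - b2 * c0)
  + a2 * (b0 * c1 - b1 * c0).

Lemma d3_jacobi (R : comNzRingType) (u0 u1 u2 v0 v1 v2 w0 w1 w2 c0 c1 c2
    u00 u01 u02 u11 u12 u22 v00 v01 v02 v11 v12 v22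
    w00 w01 w02 w11 w12 w22 c00 c01 c02 c11 c12 c22 : R) :
  d3 u0 u1 u2
    (d3 v00 v01 v02 w0 w1 w2 c0 c1 c2 + d3 v0 v1 v2 w00 w01 w02 c0 c1 c2
      + d3 v0 v1 v2 w0 w1 w2 c00 c01 c02)
    (d3 v01 v11 v12 w0 w1 w2 c0 c1 c2 + d3 v0 v1 v2 w01 w11 w12 c0 c1 c2
      + d3 v0 v1 v2 w0 w1 w2 c01 c11 c12)
    (d3 v02 v12 v22 w0 w1 w2 c0 c1 c2 + d3 v0 v1 v2 w02 w12 w22 c0 c1 c2
      + d3 v0 v1 v2 w0 w1 w2 c02 c12 c22) c0 c1 c2
  + d3 v0 v1 v2
    (d3 w00 w01 w02 u0 u1 u2 c0 c1 c2 + d3 w0 w1 w2 u00 u01 u02 c0 c1 c2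
      + d3 w0 w1 w2 u0 u1 u2 c00 c01 c02)
    (d3 w01 w11 w12 u0 u1 u2 c0 c1 c2 + d3 w0 w1 w2 u01 u11 u12 c0 c1 c2
      + d3 w0 w1 w2 u0 u1 u2 c01 c11 c12)
    (d3 w02 w12 w22 u0 u1 u2 c0 c1 c2 + d3 w0 w1 w2 u02 u12 u22 c0 c1 c2
      + d3 w0 w1 w2 u0 u1 u2 c02 c12 c22) c0 c1 c2
  + d3 w0 w1 w2
    (d3 u00 u01 u02 v0 v1 v2 c0 c1 c2 + d3 u0 u1 u2 v00 v01 v02 c0 c1 c2
      + d3 u0 u1 u2 v0 v1 v2 c00 c01 c02)
    (d3 u01 u11 u12 v0 v1 v2 c0 c1 c2 + d3 u0 u1 u2 v01 v11 v12 c0 c1 c2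
      + d3 u0 u1 u2 v0 v1 v2 c01 c11 c12)
    (d3 u02 u12 u22 v0 v1 v2 c0 c1 c2 + d3 u0 u1 u2 v02 v12 v22 c0 c1 c2
      + d3 u0 u1 u2 v0 v1 v2 c02 c12 c22) c0 c1 c2
  = 0.
Proof. rewrite /d3; ring. Qed.

Section Jacobian.
Variable K : fieldType.
Local Notation A := {mpoly K[3]}.
Implicit Types u v w c : A.

(* Row i of the Jacobian matrix holds the partial derivatives of the i-th
   function with respect to x, y, z. *)
Definition jacobian3 u v w : A :=
  \det (\matrix_(i < 3, j < 3) (tnth [tuple u; v; w] i)^`M(j)).

Lemma jacobian3E u v w : jacobian3 u v w =
  d3 u^`M(0) u^`M(1) u^`M(2) v^`M(0) v^`M(1) v^`M(2) w^`M(0) w^`M(1) w^`M(2).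
Proof. by rewrite /jacobian3 det3 !mxE. Qed.

Lemma mderiv_jacobian3 i u v w :
  (jacobian3 u v w)^`M(i) =
  jacobian3 u^`M(i) v w + jacobian3 u v^`M(i) w + jacobian3 u v w^`M(i).
Proof.
rewrite !jacobian3E /d3 !(mderivD, mderivN, mderivM) !(mderiv_comm i _).
do 3![move: (u^`M(0)^`M(i)) (u^`M(1)^`M(i)) (u^`M(2)^`M(i)) (u^`M(0))
  (u^`M(1)) (u^`M(2)) => ? ? ? ? ? ?; move: v w u => u v w].
ring.
Qed.

Lemma jacobian3_linearl c v : linear (fun u => jacobian3 u v c).
Proof.
move=> a u u'; rewrite !jacobian3E /d3 !mderivD !mderivZ -!mul_mpolyC; ring.
Qed.

Lemma jacobian3_linearr c u : linear (fun v => jacobian3 u v c).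
Proof.
move=> a v v'; rewrite !jacobian3E /d3 !mderivD !mderivZ -!mul_mpolyC; ring.
Qed.

Lemma jacobian3xx c u : jacobian3 u u c = 0.
Proof. rewrite !jacobian3E /d3; ring. Qed.

Lemma jacobian3Ml c u u' v :
  jacobian3 (u * u') v c = u * jacobian3 u' v c + jacobian3 u v c * u'.
Proof. rewrite !jacobian3E /d3 !mderivM; ring. Qed.

Lemma jacobian3_jacobi c u v w :
  jacobian3 u (jacobian3 v w c) c + jacobian3 v (jacobian3 w u c) c
    + jacobian3 w (jacobian3 u v c) c = 0.
Proof.
rewrite (jacobian3E u (jacobian3 _ _ _)) (jacobian3E v (jacobian3 _ _ _)).
rewrite (jacobian3E w (jacobian3 _ _ _)) !mderiv_jacobian3 !jacobian3E.
by rewrite !(mderiv_comm 1 0) !(mderiv_comm 2 0) !(mderiv_comm 2 1) d3_jacobi.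
Qed.

End Jacobian.

(* K[x, y, z] under a name that carries alpha, so that each alpha gets its own
   Poisson structure, with bracket {u, v} = J(u, v, C). *)
Definition elliptic (K : fieldType) (alpha : K) : Type := {mpoly K[3]}.

HB.instance Definition _ (K : fieldType) (alpha : K) :=
  GRing.ComAlgebra.copy (elliptic alpha) {mpoly K[3]}.

Section Elliptic.
Variables (K : fieldType) (alpha : K).
Local Notation A := {mpoly K[3]}.
Local Notation E := (elliptic alpha).

Definition ell_x : A := 'X_0.
Definition ell_y : A := 'X_1.
Definition ell_z : A := 'X_2.

Definition ell_C : A :=
  3%:R^-1 *: (ell_x ^+ 3 + ell_y ^+ 3 + ell_z ^+ 3)
  - alpha *: (ell_x * ell_y * ell_z).

HB.instance Definition _ := isPoisson.Build K E
  (jacobian3_linearl ell_C) (jacobian3_linearr ell_C) (jacobian3xx ell_C)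
  (jacobian3Ml ell_C) (jacobian3_jacobi ell_C).

Local Notation c3 := (3%:R^-1 * 3%:R : K).

Lemma mderivU (i j : 'I_3) : ('X_i : A)^`M(j) = (i == j)%:R.
Proof.
rewrite mderivX mnm1E; case: eqP => [->|_]; last by rewrite scale0r.
by rewrite scale1r -[X in (X - _)%MM]addm0 addmC addmK mpolyX0.
Qed.

Lemma mderivXn3 (i j : 'I_3) :
  ('X_i ^+ 3 : A)^`M(j) = (i == j)%:R *: (3%:R *: 'X_i ^+ 2).
Proof.
rewrite !exprS expr0 mulr1 !mderivM !mderivU -!mul_mpolyC.
by case: eqP => _; rewrite !rmorph_nat; ring.
Qed.

Lemma mderivC0 : ell_C^`M(0) = c3 *: ell_x ^+ 2 - alpha *: (ell_y * ell_z).
Proof.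
rewrite /ell_C mderivB !mderivZ !mderivD !mderivXn3 !mderivM !mderivU /=.
by rewrite !(scale0r, scale1r, mul0r, mulr0, mul1r, mulr1, addr0, add0r) scalerA.
Qed.

Lemma mderivC1 : ell_C^`M(1) = c3 *: ell_y ^+ 2 - alpha *: (ell_x * ell_z).
Proof.
rewrite /ell_C mderivB !mderivZ !mderivD !mderivXn3 !mderivM !mderivU /=.
by rewrite !(scale0r, scale1r, mul0r, mulr0, mul1r, mulr1, addr0, add0r) scalerA.
Qed.

Lemma mderivC2 : ell_C^`M(2) = c3 *: ell_z ^+ 2 - alpha *: (ell_x * ell_y).
Proof.
rewrite /ell_C mderivB !mderivZ !mderivD !mderivXn3 !mderivM !mderivU /=.
by rewrite !(scale0r, scale1r, mul0r, mulr0, mul1r, mulr1, addr0, add0r) scalerA.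
Qed.

Definition ell_bracketU (i j : 'I_3) : A :=
  d3 (i == 0)%:R (i == 1)%:R (i == 2)%:R (j == 0)%:R (j == 1)%:R (j == 2)%:R
    (c3 *: ell_x ^+ 2 - alpha *: (ell_y * ell_z))
    (c3 *: ell_y ^+ 2 - alpha *: (ell_x * ell_z))
    (c3 *: ell_z ^+ 2 - alpha *: (ell_x * ell_y)).

Lemma bracketU (i j : 'I_3) : bracket ('X_i : E) ('X_j : E) = ell_bracketU i j.
Proof.
rewrite [LHS]jacobian3E mderivC0 mderivC1 mderivC2 !mderivU /ell_bracketU.
by rewrite !(eq_sym i) !(eq_sym j) !(eq_sym _ i) !(eq_sym _ j).
Qed.

Lemma bracket_xy : 3%:R != 0 :> K ->
  bracket (ell_x : E) (ell_y : E) = - alpha *: (ell_x * ell_y) + ell_z ^+ 2.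
Proof.
move=> nz3; rewrite bracketU /ell_bracketU /d3 mulVf // -!mul_mpolyC.
by rewrite /= rmorphN rmorph1; ring.
Qed.

Lemma bracket_yz : 3%:R != 0 :> K ->
  bracket (ell_y : E) (ell_z : E) = - alpha *: (ell_y * ell_z) + ell_x ^+ 2.
Proof.
move=> nz3; rewrite bracketU /ell_bracketU /d3 mulVf // -!mul_mpolyC.
by rewrite /= rmorphN rmorph1; ring.
Qed.

Lemma bracket_zx : 3%:R != 0 :> K ->
  bracket (ell_z : E) (ell_x : E) = - alpha *: (ell_z * ell_x) + ell_y ^+ 2.
Proof.
move=> nz3; rewrite bracketU /ell_bracketU /d3 mulVf // -!mul_mpolyC.
by rewrite /= rmorphN rmorph1; ring.
Qed.

Lemma mpoly_gen_ind (Q : A -> Prop) :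
  Q 1 -> (forall a u v, Q u -> Q v -> Q (a *: u + v)) ->
  (forall u v, Q u -> Q v -> Q (u * v)) -> (forall i, Q 'X_i) ->
  forall p, Q p.
Proof.
move=> Q1 QD QM QX; elim/mpolyind => [|a m p _ _ Qp].
  by rewrite -(subrr 1) -scaleN1r addrC; apply: QD.
apply: QD => //; rewrite mpolyXE_id.
apply: big_ind => // i _; elim: (m i) => [|k IH]; first by rewrite expr0.
by rewrite exprS; apply: QM.
Qed.

(* The algebra endomorphism x |-> t`_0, y |-> t`_1, z |-> t`_2. *)
Definition ell_subst (t : 3.-tuple A) (p : E) : E := (p : A) \mPo t.

Lemma ell_substU t (i : 'I_3) : ell_subst t ('X_i : A) = t`_i.
Proof. exact: comp_mpolyXU. Qed.

Lemma ell_subst_linear t : linear (ell_subst t).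
Proof. by move=> a u v; rewrite /ell_subst comp_mpolyD comp_mpolyZ. Qed.

Lemma ell_substM t : {morph ell_subst t : a b / a * b}.
Proof. by move=> a b; rewrite /ell_subst rmorphM. Qed.

Lemma ell_subst1 t : ell_subst t 1 = 1.
Proof. exact: comp_mpoly1. Qed.

Lemma ell_substK (t t' : 3.-tuple A) :
  (forall i : 'I_3, ell_subst t' (t`_i : A) = ('X_i : A)) ->
  cancel (ell_subst t) (ell_subst t').
Proof.
move=> h; apply: mpoly_gen_ind => [|a u v eu ev|u v eu ev|i].
- by rewrite !ell_subst1.
- by rewrite !ell_subst_linear eu ev.
- by rewrite !ell_substM eu ev.
- by rewrite ell_substU h.
Qed.

Lemma ell_der_ext t (D D' : E -> E) : linear D -> linear D' ->
  (forall a b, D (a * b) = ell_subst t a * D b + D a * ell_subst t b) ->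
  (forall a b, D' (a * b) = ell_subst t a * D' b + D' a * ell_subst t b) ->
  (forall i : 'I_3, D ('X_i : A) = D' ('X_i : A)) -> D =1 D'.
Proof.
move=> lD lD' dD dD' h.
have D1 F : (forall a b, F (a * b) = ell_subst t a * F b + F a * ell_subst t b)
    -> F 1 = 0.
  move=> dF; have := dF 1 1; rewrite !mulr1 ell_subst1 mul1r mulr1 => /eqP.
  by rewrite -subr_eq0 opprD addrA subrr sub0r oppr_eq0 => /eqP.
apply: mpoly_gen_ind => [|a u v eu ev|u v eu ev|i]; last exact: h.
- by rewrite !D1.
- by rewrite lD lD' eu ev.
- by rewrite dD dD' eu ev.
Qed.

Lemma bracketMr (a b c : E) :
  bracket a (b * c) = b * bracket a c + bracket a b * c.
Proof.
have anti (u v : E) : bracket u v = - bracket v u.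
  apply/eqP; rewrite -addr_eq0; apply/eqP.
  have := bracketxx (u + v).
  have := bracket_linearl (u + v) 1 u v; rewrite scale1r => ->; rewrite scale1r.
  have := bracket_linearr u 1 u v; rewrite scale1r => ->.
  have := bracket_linearr v 1 u v; rewrite scale1r => ->.
  by rewrite !scale1r !bracketxx add0r addr0.
by rewrite anti bracketMl !(anti a) mulrN mulNr opprD.
Qed.

Lemma ell_subst_aut (t t' : 3.-tuple A) :
  (forall i : 'I_3, ell_subst t' (t`_i : A) = ('X_i : A)) ->
  (forall i : 'I_3, ell_subst t (t'`_i : A) = ('X_i : A)) ->
  (forall i j : 'I_3,
     ell_subst t (bracket ('X_i : E) ('X_j : E)) =
     bracket ((t`_i : A) : E) ((t`_j : A) : E)) ->
  poisson_aut (ell_subst t).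
Proof.
move=> h1 h2 h3; have lt := ell_subst_linear t; have mt := ell_substM t.
split=> //; first by exists (ell_subst t'); apply: ell_substK.
move=> u v; move: u.
apply: (@ell_der_ext t).
- by move=> a u w; rewrite bracket_linearl lt.
- by move=> a u w; rewrite lt bracket_linearl.
- move=> a b; rewrite bracketMl /=.
  by have := lt 1 (a * bracket b v) (bracket a v * b);
     rewrite !scale1r => ->; rewrite !mt.
- by move=> a b; rewrite mt bracketMl.
move=> i /=; move: v; apply: (@ell_der_ext t).
- by move=> a u w; rewrite bracket_linearr lt.
- by move=> a u w; rewrite lt bracket_linearr.
- move=> a b; rewrite bracketMr.
  by have := lt 1 (a * bracket ('X_i : E) b) (bracket ('X_i : E) a * b);
     rewrite !scale1r => ->; rewrite !mt.
- by move=> a b; rewrite mt bracketMr.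
by move=> j; rewrite h3 !ell_substU.
Qed.

End Elliptic.

Section Generators.
Variables (K : fieldType) (alpha : K).
Local Notation A := {mpoly K[3]}.
Local Notation E := (elliptic alpha).
Local Notation x := (ell_x K).
Local Notation y := (ell_y K).
Local Notation z := (ell_z K).
Local Notation sub := (@ell_subst K alpha).

Lemma ord3_case (Q : 'I_3 -> Prop) : Q 0 -> Q 1 -> Q 2 -> forall i, Q i.
Proof.
by move=> q0 q1 q2 [[|[|[|k]]] lt_i3] //;
  [move: q0|move: q1|move: q2]; congr Q; apply: val_inj.
Qed.

Definition ell_dC (u v w : A) : A :=
  (3%:R^-1 * 3%:R) *: u ^+ 2 - alpha *: (v * w).

Lemma bracketUE (i j : 'I_3) : bracket ('X_i : E) ('X_j : E) =
  d3 (i == 0)%:R (i == 1)%:R (i == 2)%:R (j == 0)%:R (j == 1)%:R (j == 2)%:R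
    (ell_dC x y z) (ell_dC y x z) (ell_dC z x y) :> A.
Proof. exact: bracketU. Qed.

Lemma ell_substZ (t : 3.-tuple A) (k : K) (p : E) :
  sub t (k *: p) = k *: sub t p.
Proof. exact: comp_mpolyZ. Qed.

Lemma ell_subst_d3 (t : 3.-tuple A) (i j : 'I_3) (u v w : A) :
  sub t (d3 (i == 0)%:R (i == 1)%:R (i == 2)%:R
                  (j == 0)%:R (j == 1)%:R (j == 2)%:R u v w : A) =
  d3 (i == 0)%:R (i == 1)%:R (i == 2)%:R (j == 0)%:R (j == 1)%:R (j == 2)%:R
    (sub t (u : E) : A) (sub t (v : E) : A)
    (sub t (w : E) : A) :> A.
Proof. by rewrite /ell_subst /d3 !(rmorphD, rmorphN, rmorphM, rmorph_nat). Qed.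

Lemma ell_subst_dC (t : 3.-tuple A) (u v w : A) :
  sub t (ell_dC u v w : E) =
  ell_dC (sub t (u : E)) (sub t (v : E)) (sub t (w : E)) :> A.
Proof.
by rewrite /ell_subst /ell_dC comp_mpolyB !comp_mpolyZ rmorphXn rmorphM.
Qed.

Lemma bracketZZ (a b : K) (u v : E) :
  bracket (a *: u) (b *: v) = (a * b) *: bracket u v.
Proof.
have b0l (w : E) : bracket 0 w = 0.
  by have := bracket_linearl w (-1) 0 0; rewrite scaler0 addr0 scaleN1r addNr.
have b0r (w : E) : bracket w 0 = 0.
  by have := bracket_linearr w (-1) 0 0; rewrite scaler0 addr0 scaleN1r addNr.
have := bracket_linearl (b *: v) a u 0; rewrite !addr0 b0l addr0 => ->.
have := bracket_linearr u b v 0; rewrite !addr0 b0r addr0 => ->.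
by rewrite scalerA.
Qed.

Lemma ell_dCZ (a b c : K) (u v w : A) : a ^+ 2 = b * c ->
  ell_dC (a *: u) (b *: v) (c *: w) = (b * c) *: ell_dC u v w.
Proof.
move=> e; rewrite /ell_dC exprZn e scalerBr !scalerA -scalerAl -scalerAr.
by rewrite !scalerA; congr (_ *: _ - _ *: _); ring.
Qed.

Lemma diag_aut (a b c : K) (t := [tuple a *: x; b *: y; c *: z]) :
  a != 0 -> b != 0 -> c != 0 ->
  a ^+ 2 = b * c -> b ^+ 2 = c * a -> c ^+ 2 = a * b ->
  poisson_aut (sub t : E -> E).
Proof.
move=> a0 b0 c0 ea eb ec.
apply: (@ell_subst_aut _ _ t [tuple a^-1 *: x; b^-1 *: y; c^-1 *: z]).
- by apply: ord3_case; rewrite ell_substZ ell_substU /= scalerA ?mulfV // scale1r.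
- by apply: ord3_case; rewrite ell_substZ ell_substU /= scalerA ?mulVf // scale1r.
have tx : sub t (x : E) = a *: x by rewrite ell_substU.
have ty : sub t (y : E) = b *: y by rewrite ell_substU.
have tz : sub t (z : E) = c *: z by rewrite ell_substU.
move=> i j; rewrite bracketUE ell_subst_d3 !ell_subst_dC tx ty tz.
rewrite !ell_dCZ // 1?[a * c]mulrC //.
move: i j; do 2![apply: ord3_case]; rewrite bracketZZ bracketUE /d3 /=.
all: by rewrite -?mul_mpolyC ?rmorphM; ring.
Qed.

Lemma ell_phi_subproof (g : K) : g != 0 ->
  poisson_aut (sub [tuple g *: x; g *: y; g *: z] : E -> E).
Proof. by move=> g0; apply: diag_aut. Qed.

Lemma ell_tau_subproof : poisson_aut (sub [tuple y; z; x] : E -> E).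
Proof.
set t := [tuple y; z; x].
apply: (@ell_subst_aut _ _ t [tuple z; x; y]).
- by apply: ord3_case; rewrite ell_substU.
- by apply: ord3_case; rewrite ell_substU.
have tx : sub t (x : E) = y by rewrite ell_substU.
have ty : sub t (y : E) = z by rewrite ell_substU.
have tz : sub t (z : E) = x by rewrite ell_substU.
move=> i j; rewrite bracketUE ell_subst_d3 !ell_subst_dC tx ty tz.
have dCC u v w : ell_dC u v w = ell_dC u w v by rewrite /ell_dC (mulrC v).
rewrite (dCC y z) (dCC z y).
move: i j; apply: ord3_case; apply: ord3_case; rewrite [RHS]bracketUE /d3 /=; ring.
Qed.

Variables (eps : K) (heps : eps ^+ 2 + eps + 1 = 0).

Lemma eps_neq0 : eps != 0.
Proof.
apply/eqP => e0; move: heps; rewrite e0 expr0n /= !add0r => /eqP.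
by rewrite oner_eq0.
Qed.

Lemma eps3 : eps ^+ 3 = 1.
Proof.
have -> : eps ^+ 3 = (eps - 1) * (eps ^+ 2 + eps + 1) + 1 by ring.
by rewrite heps mulr0 add0r.
Qed.

Lemma ell_sigma_subproof :
  poisson_aut (sub [tuple x; eps *: y; eps ^+ 2 *: z] : E -> E).
Proof.
have e0 := eps_neq0; rewrite -[x]scale1r; apply: diag_aut.
- exact: oner_neq0.
- exact: e0.
- by rewrite expf_neq0.
- by rewrite -exprS eps3 expr1n.
- by rewrite mulr1.
- by rewrite mul1r -exprM (exprD eps 3 1) eps3 mul1r.
Qed.

Definition Kunit := {c : K | c != 0}.

Lemma Kunit_mul_subproof (g h : Kunit) : val g * val h != 0.
Proof. by rewrite mulf_neq0 ?(valP g) ?(valP h). Qed.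

Definition Kunit_mul (g h : Kunit) : Kunit :=
  exist _ (val g * val h) (Kunit_mul_subproof g h).

Definition Kunit_eps : Kunit := exist _ eps eps_neq0.

Definition ell_phi (g : Kunit) : pAut E := mk_pAut (ell_phi_subproof (valP g)).
Definition ell_tau : pAut E := mk_pAut ell_tau_subproof.
Definition ell_sigma : pAut E := mk_pAut ell_sigma_subproof.

Inductive ell_gen : Type := Phi of Kunit | Sigma | Tau.

Definition ell_gen_aut (s : ell_gen) : pAut E :=
  match s with Phi g => ell_phi g | Sigma => ell_sigma | Tau => ell_tau end.

(* A word without inverse letters; the word [:: s1; s2] evaluates to the composite
   automorphism f |-> s1 (s2 f). *)
Definition ell_word (s : seq ell_gen) : word ell_gen := [seq (false, l) | l <- s].

Inductive ell_rel : word ell_gen -> word ell_gen -> Prop :=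
| RelPhiPhi g h :
    ell_rel (ell_word [:: Phi g; Phi h]) (ell_word [:: Phi (Kunit_mul g h)])
| RelSigmaPhi g : ell_rel (ell_word [:: Sigma; Phi g]) (ell_word [:: Phi g; Sigma])
| RelTauPhi g : ell_rel (ell_word [:: Tau; Phi g]) (ell_word [:: Phi g; Tau])
| RelSigma3 : ell_rel (ell_word [:: Sigma; Sigma; Sigma]) (ell_word [::])
| RelTau3 : ell_rel (ell_word [:: Tau; Tau; Tau]) (ell_word [::])
| RelSigmaTau :
    ell_rel (ell_word [:: Sigma; Tau])
            (ell_word [:: Phi Kunit_eps; Tau; Sigma]).

End Generators.

(* Main.v *)
Require Import Defs.
From mathcomp Require Import all_boot all_order all_algebra.
From mathcomp Require Import boolp mpoly.
From mathcomp Require Import ring.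

(** Let [phi] be a Poisson automorphism and [f], [g], [h] the images of [x],
    [y], [z].  Being Poisson means that the brackets of [f], [g], [h] are the
    partial derivatives of [C] evaluated at [(f, g, h)]:
    [{f, g} = h^2 - alpha f g] and cyclically ([poisson_triple]).  The point is
    that this forces [f], [g], [h] to be linear forms, and then monomials.

    Degree one.  The bracket has degree 0, so the parts [F], [G], [H] of the
    highest occurring degree [d] satisfy the same three equations.  By the chain
    rule the Jacobian [J(f, g, h)] is a nonzero constant; hence [J(F, G, H) = 0]
    if [d > 1].  Euler's identity and Cramer's rule give
    [d C(F, G, H) = J(F, G, H) C] ([poisson_triple_cubic]), so [(F : G : H)] is
    a rational map to the cubic [C = 0].  This cubic is smooth, as
    [alpha^3 <> 1], so it is an elliptic curve and such a map is constant.  The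
    elementary reason ([wronsk0]), along a line and with common factors removed:
    the vector of Wronskians of [(F, G, H)] is orthogonal to [(F, G, H)] and to
    its derivative, as is the gradient of [C], whose entries are coprime; so it
    is a polynomial multiple of the gradient, but the degree of the gradient is
    larger, and the multiple is 0.  Proportional polynomials have zero brackets,
    so the gradient of [C] vanishes at [(F, G, H)], whence [F = G = H = 0] by
    smoothness: a contradiction.  Constant terms vanish in the same way,
    because all brackets vanish at the origin.

    Linear maps.  Let [delta] be the determinant of the linear map.  The
    equations give [C o phi = delta C], and the Hessian determinant of [C] is
    multiplied by [delta] as well ([hess_img]).  As [alpha^3 <> 1], [C] and its
    Hessian span the pencil of [x^3 + y^3 + z^3] and [x y z], so
    [f g h = delta x y z] ([prod_img]): the map permutes the lines of the
    coordinate triangle, hence is monomial.  The three equations exclude odd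
    permutations and leave exactly the maps [phi_p tau^j sigma^i]
    ([hesse_linearP]).

    Presentation.  The relations bring every word to the form
    [phi_g tau^j sigma^i] ([word_normal]), and the automorphism determines [g]
    and the residues of [j] and [i] modulo 3 ([eval_normal_inj]). *)

Set Implicit Arguments.
Unset Strict Implicit.
Unset Printing Implicit Defensive.

Import GRing.Theory.
Local Open Scope ring_scope.

(** * The gradient of the Hesse cubic *)

(** The partial derivative of [C] in its first variable, at [(f, g, h)] with
    parameter [a]; the other two are its cyclic shifts. *)
Definition hesse_grad (R : comNzRingType) (a f g h : R) : R := f ^+ 2 - a * (g * h).

(** An effective form of the smoothness of the cubic: the ideal of the three
    partial derivatives contains the fourth powers of the variables. *)
Lemma hesse_grad_expr4 (R : comNzRingType) (a f g h : R) :
  (1 - a ^+ 3) * f ^+ 4 =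
    hesse_grad a f g h * (f ^+ 2 * (1 - a ^+ 3) + a * (g * h))
    + hesse_grad a g h f * (a ^+ 2 * h ^+ 2)
    + hesse_grad a h f g * (a ^+ 3 * (f * h)).
Proof. rewrite /hesse_grad; ring. Qed.

Lemma hesse_grad_eq0 (R : idomainType) (a f g h : R) : a ^+ 3 != 1 ->
  hesse_grad a f g h = 0 -> hesse_grad a g h f = 0 -> hesse_grad a h f g = 0 ->
  f = 0.
Proof.
move=> a31 ef eg eh; have := hesse_grad_expr4 a f g h.
rewrite ef eg eh !mul0r !addr0 => /eqP.
by rewrite mulf_eq0 subr_eq0 eq_sym (negPf a31) expf_eq0 /= => /eqP.
Qed.

(** * Polynomial points of the Hesse cubic *)

Section Univariate.
Variables (L : fieldType) (a : L).
Hypotheses (n3 : 3%:R != 0 :> L) (a31 : a ^+ 3 != 1).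
Implicit Types e f g h : {poly L}.

Local Notation grad := (hesse_grad a%:P).

Lemma dvdp_hesse_expr4 e f g h :
  e %| grad f g h -> e %| grad g h f -> e %| grad h f g -> e %| f ^+ 4.
Proof.
move=> df dg dh.
have a0 : 1 - a ^+ 3 != 0 by rewrite subr_eq0 eq_sym.
rewrite -(dvdpZr _ _ a0) -mul_polyC rmorphB rmorph1 rmorphXn (hesse_grad_expr4 _ _ g h).
by rewrite !dvdp_add ?dvdp_mulr.
Qed.

Lemma common_root_expr n e f : (1 < size e)%N -> e %| f ^+ n ->
  (1 < size (gcdp e f))%N.
Proof.
move=> e1 ef; rewrite ltnNge; apply/negP => s1.
have e0 : e != 0 by rewrite -size_poly_gt0 (ltn_trans _ e1).
have ce : coprimep e f.
  by rewrite /coprimep eqn_leq s1 size_poly_gt0 gcdp_eq0 (negPf e0).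
have : coprimep e (f ^+ n) by apply: coprimep_expr.
move/(coprimep_dvdl ef).
by rewrite /coprimep gcdpp => /eqP s; rewrite s in e1.
Qed.

(** No common divisor of positive degree.  The zero triple is excluded, since
    it has the common divisor ['X]. *)
Definition coprime3 f g h := forall e, e %| f -> e %| g -> e %| h -> (size e <= 1)%N.

Lemma coprime3C f g h : coprime3 f g h -> coprime3 g h f.
Proof. by move=> cop e eg eh ef; apply: cop. Qed.

Lemma hesse_grad_coprime f g h : coprime3 f g h ->
  coprime3 (grad f g h) (grad g h f) (grad h f g).
Proof.
move=> cop e df dg dh; rewrite leqNgt; apply/negP => e1.
have e4f := dvdp_hesse_expr4 df dg dh.
have e4g := dvdp_hesse_expr4 dg dh df.
have e4h := dvdp_hesse_expr4 dh df dg.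
have s1 := common_root_expr e1 e4f.
have s2 := common_root_expr s1 (dvdp_trans (dvdp_gcdl _ _) e4g).
have s3 := common_root_expr s2
  (dvdp_trans (dvdp_gcdl _ _) (dvdp_trans (dvdp_gcdl _ _) e4h)).
move: s3; rewrite ltnNge => /negP; apply; apply: cop.
- apply: dvdp_trans (dvdp_gcdl _ _) (dvdp_trans (dvdp_gcdl _ _) _).
  exact: dvdp_gcdr.
- exact: dvdp_trans (dvdp_gcdl _ _) (dvdp_gcdr _ _).
- exact: dvdp_gcdr.
Qed.

Lemma coprime3_dvdpM f g h w : coprime3 f g h -> f %| g * w -> f %| h * w ->
  f %| w.
Proof.
move=> cop fg fh.
have [/eqP f0|gcd0] := eqVneq (gcdp f (gcdp g h)) 0.
  move: f0; rewrite !gcdp_eq0 => /andP[/eqP f0 /andP[/eqP g0 /eqP h0]].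
  by have := cop 'X; rewrite f0 g0 h0 !dvdp0 size_polyX => /(_ isT isT isT).
have s1 : size (gcdp f (gcdp g h)) == 1%N.
  rewrite eqn_leq size_poly_gt0 gcd0 andbT; apply: cop.
  - exact: dvdp_gcdl.
  - exact: dvdp_trans (dvdp_gcdr _ _) (dvdp_gcdl _ _).
  - exact: dvdp_trans (dvdp_gcdr _ _) (dvdp_gcdr _ _).
have : f %| gcdp g h * w.
  by rewrite (eqp_dvdr _ (mulp_gcdl _ _ _)) dvdp_gcd fg fh.
by rewrite Gauss_dvdpr.
Qed.

Lemma coefM_top n m f g : (size f <= n.+1)%N -> (size g <= m.+1)%N ->
  (f * g)`_(n + m)%N = f`_n * g`_m.
Proof.
move=> sf sg; rewrite coefM.
have ltn : (n < (n + m).+1)%N by rewrite ltnS leq_addr.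
rewrite (bigD1 (Ordinal ltn)) //= addKn big1 ?addr0 // => i ne.
have [lt|gt|e] := ltngtP i n; last by case/eqP: ne; apply: val_inj.
- by rewrite [g`__]nth_default ?mulr0 // (leq_trans sg) // ltn_subRL ltn_add2r.
- by rewrite nth_default ?mul0r // (leq_trans sf).
Qed.

Lemma coef_hesse_grad n f g h : (size f <= n.+1)%N -> (size g <= n.+1)%N ->
  (size h <= n.+1)%N -> (grad f g h)`_(n + n)%N = hesse_grad a f`_n g`_n h`_n.
Proof.
by move=> sf sg sh; rewrite /hesse_grad coefB coefCM !expr2 !coefM_top.
Qed.

Definition wronsk f g : {poly L} := f * g^`() - g * f^`().

(** One less than the generic bound for a product: this is where the degree
    count against the gradient, of degree [2 n], becomes strict. *)
Lemma size_wronsk n f g : (size f <= n.+1)%N -> (size g <= n.+1)%N ->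
  (size (wronsk f g) <= n + n)%N.
Proof.
have sM (u v : {poly L}) : (size u <= n.+1)%N -> (size v <= n.+1)%N ->
    (size (u * v^`() : {poly L})%R <= n + n)%N.
  move=> su sv; have [->|v0] := eqVneq v 0.
    by rewrite deriv0 mulr0 size_poly0.
  apply: leq_trans (size_polyMleq _ _) _.
  have sv' : (size v^`() <= n)%N by rewrite -ltnS (leq_trans (lt_size_deriv v0)).
  by rewrite -subn1 leq_subLR add1n -addSn leq_add.
by move=> sf sg; rewrite (leq_trans (size_polyD _ _)) // size_polyN geq_max !sM.
Qed.

Definition hesse_cubic f g h :=
  f ^+ 3 + g ^+ 3 + h ^+ 3 = 3%:R * a%:P * (f * g * h).

Lemma hesse_cubicC f g h : hesse_cubic f g h -> hesse_cubic g h f.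
Proof. by rewrite /hesse_cubic => e; rewrite addrC addrA e; ring. Qed.

(** The gradient of the cubic and the vector of Wronskians are both orthogonal
    to [(f, g, h)], by Euler's identity, and to its derivative, by the chain
    rule; so they are proportional, and this is one of the three minors. *)
Lemma hesse_grad_wronsk f g h : hesse_cubic f g h ->
  grad f g h * wronsk h f = grad g h f * wronsk g h.
Proof.
move=> eC.
have n3P : 3%:R != 0 :> {poly L} by rewrite -polyC_natr polyC_eq0.
have E0 : f * grad f g h + g * grad g h f + h * grad h f g = 0.
  rewrite /hesse_grad -[RHS](subrr (3%:R * a%:P * (f * g * h))) -{1}eC; ring.
have E1 : f^`() * grad f g h + g^`() * grad g h f + h^`() * grad h f g = 0.
  apply: (mulfI n3P); rewrite mulr0.
  have : (f ^+ 3 + g ^+ 3 + h ^+ 3 - 3%:R * a%:P * (f * g * h))^`() = 0.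
    by rewrite eC subrr deriv0.
  rewrite -polyC_natr -polyCM !exprS !expr0 !derivE !polyCM polyC_natr /hesse_grad.
  move=> <-; ring.
have -> : grad g h f * wronsk g h =
    (f * grad f g h + g * grad g h f + h * grad h f g) * h^`()
    - (f^`() * grad f g h + g^`() * grad g h f + h^`() * grad h f g) * h
    + grad f g h * wronsk h f by rewrite /wronsk; ring.
by rewrite E0 E1 !mul0r subr0 add0r.
Qed.

(** [grad f g h] divides [grad g h f * wronsk g h] and [grad h f g * wronsk g h],
    hence [wronsk g h] by coprimality, and it has the larger degree as its
    coefficient of degree [2 n] does not vanish. *)
Lemma wronsk0_top n f g h : coprime3 f g h -> hesse_cubic f g h ->
  (size f <= n.+1)%N -> (size g <= n.+1)%N -> (size h <= n.+1)%N ->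
  hesse_grad a f`_n g`_n h`_n != 0 ->
  [/\ wronsk f g = 0, wronsk g h = 0 & wronsk h f = 0].
Proof.
move=> cop eC sf sg sh top.
have eC' := hesse_cubicC eC; have eC'' := hesse_cubicC eC'.
have Atop : (n + n < size (grad f g h))%N.
  rewrite ltnNge; apply: contra top => s.
  by rewrite -coef_hesse_grad // nth_default.
have A0 : grad f g h != 0 by rewrite -size_poly_gt0 (leq_ltn_trans _ Atop).
have W1 : wronsk g h = 0.
  apply/eqP; apply: contraLR (size_wronsk sg sh) => w0; rewrite -ltnNge.
  apply: leq_trans Atop (dvdp_leq w0 _).
  apply: (coprime3_dvdpM (hesse_grad_coprime cop)).
    by rewrite -(hesse_grad_wronsk eC) dvdp_mulr.
  by rewrite (hesse_grad_wronsk eC'') dvdp_mulr.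
split=> //; apply: (mulfI A0); rewrite mulr0.
  by rewrite -(hesse_grad_wronsk eC'') W1 mulr0.
by rewrite (hesse_grad_wronsk eC) W1 mulr0.
Qed.

(** The leading coefficients of [f], [g], [h] in the largest degree are not all
    zero, so by smoothness one of the three entries of the gradient has the
    maximal degree; the cyclic symmetry makes it the first one. *)
Lemma wronsk0_coprime f g h : coprime3 f g h -> hesse_cubic f g h ->
  wronsk f g = 0.
Proof.
move=> cop eC.
pose n := (maxn (size f) (maxn (size g) (size h))).-1%N.
have [|m0] := posnP (maxn (size f) (maxn (size g) (size h))).
  move/eqP; rewrite -leqn0 !geq_max !leqn0 !size_poly_eq0.
  by move=> /andP[/eqP-> _]; rewrite /wronsk deriv0 mul0r mulr0 subrr.
have nE : n.+1 = maxn (size f) (maxn (size g) (size h)) by rewrite prednK.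
have sf : (size f <= n.+1)%N by rewrite nE leq_maxl.
have sg : (size g <= n.+1)%N by rewrite nE maxnCA leq_maxl.
have sh : (size h <= n.+1)%N by rewrite nE !leq_max leqnn !orbT.
have [e1|/(wronsk0_top cop eC sf sg sh)[]//] :=
  eqVneq (hesse_grad a f`_n g`_n h`_n) 0.
have eC' := hesse_cubicC eC; have eC'' := hesse_cubicC eC'.
have cop' := coprime3C cop; have cop'' := coprime3C cop'.
have [e2|/(wronsk0_top cop' eC' sg sh sf)[]//] :=
  eqVneq (hesse_grad a g`_n h`_n f`_n) 0.
have [e3|/(wronsk0_top cop'' eC'' sh sf sg)[]//] :=
  eqVneq (hesse_grad a h`_n f`_n g`_n) 0.
have lower (p : {poly L}) : (size p <= n.+1)%N -> p`_n = 0 -> (size p <= n)%N.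
  move=> sp p0; rewrite leqNgt; apply/negP => lt.
  have sE : size p = n.+1 by apply/eqP; rewrite eqn_leq sp.
  by move/eqP: p0; rewrite -[n]/(n.+1.-1) -sE lead_coef_eq0 -size_poly_eq0 sE.
have : (maxn (size f) (maxn (size g) (size h)) <= n)%N.
  rewrite !geq_max !lower //.
  - exact: hesse_grad_eq0 e3 e1 e2.
  - exact: hesse_grad_eq0 e2 e3 e1.
  - exact: hesse_grad_eq0 e1 e2 e3.
by rewrite -nE ltnn.
Qed.

(** The cubic and the Wronskian are homogeneous, so the greatest common divisor
    can be factored out. *)
Lemma wronsk0 f g h : hesse_cubic f g h -> wronsk f g = 0.
Proof.
move=> eC; pose e := gcdp f (gcdp g h).
have [e0|e0] := eqVneq e 0.
  move/eqP: e0; rewrite !gcdp_eq0 => /andP[/eqP-> _].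
  by rewrite /wronsk deriv0 mul0r mulr0 subrr.
have eM d : d * e %| f -> d * e %| g -> d * e %| h -> (size d <= 1)%N.
  move=> df dg dh; have : d * e %| gcdp f (gcdp g h) by rewrite !dvdp_gcd df dg dh.
  move/(dvdp_leq e0).
  have [->|d0] := eqVneq d 0; first by rewrite size_poly0.
  by rewrite size_mul // -subn1 leq_subLR leq_add2r.
have [p fE] := dvdpP _ _ (dvdp_gcdl _ _ : e %| f).
have [q gE] := dvdpP _ _ (dvdp_trans (dvdp_gcdr _ _) (dvdp_gcdl _ _) : e %| g).
have [r hE] := dvdpP _ _ (dvdp_trans (dvdp_gcdr _ _) (dvdp_gcdr _ _) : e %| h).
clearbody e; subst f g h.
suff w : wronsk p q = 0.
  rewrite /wronsk !derivM; transitivity (e ^+ 2 * wronsk p q).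
    by rewrite /wronsk; ring.
  by rewrite w mulr0.
apply: (@wronsk0_coprime _ _ r).
  by move=> d dp dq dr; apply: eM; apply: dvdp_mul.
have e30 : e ^+ 3 != 0 by rewrite expf_neq0.
apply: (mulfI e30); transitivity ((p * e) ^+ 3 + (q * e) ^+ 3 + (r * e) ^+ 3).
  by ring.
by rewrite eC; ring.
Qed.
End Univariate.

(** * Rational maps to the Hesse cubic in three variables *)

Section Line.
Variables (K : fieldType) (a : K).
Local Notation A := {mpoly K[3]}.
Local Notation L := {fraction A}.
Implicit Types (i j : 'I_3) (u v f g h : A).

(** [T] restricts a polynomial to the line through the generic point in the
    direction of the [i]-th axis, with coefficients in the function field; the
    partial derivative becomes the derivative in one variable, and the value at
    0 gives the polynomial back. *)
Section TaylorLine.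
Variables (i : 'I_3) (T : {rmorphism A -> {poly L}}).
Hypotheses (TC : forall c, T c%:MP = (tofrac c%:MP)%:P).
Hypotheses (TX : forall j, T 'X_j = (tofrac 'X_j)%:P + (i == j)%:R *: 'X).

Lemma taylor_lineZ (c : K) u : T (c *: u) = (tofrac c%:MP) *: T u.
Proof. by rewrite -mul_mpolyC rmorphM TC mul_polyC. Qed.

Lemma horner_taylor_line u : (T u).[0] = tofrac u.
Proof.
move: u; apply: mpoly_gen_ind => [|c u v eu ev|u v eu ev|j].
- by rewrite rmorph1 hornerC.
- by rewrite rmorphD taylor_lineZ hornerD hornerZ eu ev -(mul_mpolyC c u) tofracD tofracM.
- by rewrite rmorphM hornerM eu ev tofracM.
- by rewrite TX hornerD hornerC hornerZ hornerX mulr0 addr0.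
Qed.

Lemma deriv_taylor_line u : (T u)^`() = T u^`M(i).
Proof.
move: u; apply: mpoly_gen_ind => [|c u v eu ev|u v eu ev|j].
- by rewrite rmorph1 derivC -[1]/(1%:MP) mderivC rmorph0.
- by rewrite rmorphD taylor_lineZ derivD derivZ eu ev mderivD mderivZ rmorphD taylor_lineZ.
- by rewrite rmorphM derivM eu ev mderivM rmorphD !rmorphM.
- rewrite TX derivD derivC derivZ derivX add0r mderivU eq_sym.
  by case: eqP => _; rewrite ?scale1r ?scale0r ?rmorph1 ?rmorph0.
Qed.

End TaylorLine.

Lemma taylor_line_exists (i : 'I_3) : exists T : {rmorphism A -> {poly L}},
  (forall c, T c%:MP = (tofrac c%:MP)%:P) /\
  (forall j, T 'X_j = (tofrac 'X_j)%:P + (i == j)%:R *: 'X).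
Proof.
pose c : {rmorphism K -> {poly L}} := (polyC \o (@tofrac A \o @mpolyC 3 K)).
pose T : {rmorphism A -> {poly L}} :=
  mmap c (fun j => (tofrac 'X_j)%:P + (i == j)%:R *: 'X).
by exists T; split=> [b|j]; rewrite /T /= ?mmapC // mmapX mmap1U.
Qed.

(** The one-variable statement on generic lines: the three polynomials have
    pairwise proportional gradients, that is, constant ratios. *)
Lemma hesse_curve_mderiv i f g h : 3%:R != 0 :> K -> a ^+ 3 != 1 ->
  f ^+ 3 + g ^+ 3 + h ^+ 3 = 3%:R * a%:MP * (f * g * h) ->
  f * g^`M(i) = g * f^`M(i).
Proof.
move=> n3 a31 eC.
pose b : L := tofrac a%:MP.
have n3L : 3%:R != 0 :> L.
  by rewrite -(rmorph_nat (@tofrac A)) -(rmorph_nat (@mpolyC 3 K)) tofrac_eq0 mpolyC_eq0.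
have b31 : b ^+ 3 != 1.
  rewrite /b -rmorphXn -(rmorph1 (@tofrac A)) /= tofrac_eq -rmorphXn /=.
  by rewrite -subr_eq0 -mpolyC1 -mpolyCB mpolyC_eq0 subr_eq0.
have [T [TC TX]] := taylor_line_exists i.
have : wronsk (T f) (T g) = 0.
  apply: (wronsk0 n3L b31 (h := T h)).
  by rewrite /hesse_cubic -!rmorphXn -!rmorphD eC !rmorphM rmorph_nat TC.
rewrite /wronsk !(deriv_taylor_line TC TX) -!rmorphM -rmorphB => w0.
have := horner_taylor_line TC TX (f * g^`M(i) - g * f^`M(i)).
rewrite w0 horner0 => /esym/eqP; rewrite tofrac_eq0 subr_eq0.
by move/eqP.
Qed.
End Line.

(** * Top-degree forms *)

Section Top.
Variables (K : fieldType) (n : nat).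
Local Notation A := {mpoly K[n]}.
Implicit Types (f g F G : A) (d e : nat) (m : 'X_{1..n}).

(** [F], possibly zero, is the component of degree [d] of an [f] of degree at most
    [d].  As a relation this passes through sums, products and derivatives
    without computing components. *)
Definition top_form d f F := F \is d.-homog /\ (msize (f - F) <= d)%N.

Lemma mcoeff_pihomog d f m :
  (pihomog mdeg d f)@_m = if mdeg m == d then f@_m else 0.
Proof.
elim/mpolyind: f => [|c k p _ _ IH]; first by rewrite pihomog0 !mcoeff0 if_same.
rewrite linearD linearZ /= !mcoeffD !mcoeffZ IH pihomogX mcoeffX.
have [<-|ne] := eqVneq k m.
  by case: ifP => _; rewrite ?mcoeffX ?eqxx ?mcoeff0 ?mulr0 ?addr0.
case: (mdeg k == d); rewrite ?mcoeffX ?mcoeff0 ?(negPf ne) mulr0 add0r.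
all: by case: ifP; rewrite ?add0r ?mulr0 ?add0r.
Qed.

Lemma msize_leP f d :
  reflect (forall m, (d <= mdeg m)%N -> f@_m = 0) (msize f <= d)%N.
Proof.
apply: (iffP idP) => [sf m dm|h].
  by apply: memN_msupp_eq0; apply: msize_mdeg_ge; apply: leq_trans dm.
rewrite msizeE; apply/bigmax_leqP_seq => m mf _; rewrite ltnNge.
by apply: contraTN mf => /h /eqP; rewrite mcoeff_eq0.
Qed.

Lemma top_form_pihomog d f :
  (msize f <= d.+1)%N -> top_form d f (pihomog mdeg d f).
Proof.
move=> sf; split; first exact: pihomogP.
apply/msize_leP => m dm; rewrite mcoeffB mcoeff_pihomog.
case: eqP => [_|/eqP ne]; first by rewrite subrr.
by rewrite subr0; move/msize_leP: sf; apply; rewrite ltn_neqAle eq_sym ne.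
Qed.

Lemma homog_msize_eq0 d f : f \is d.-homog -> (msize f <= d)%N -> f = 0.
Proof.
move=> hf /msize_leP sf; apply/mpolyP => m; rewrite mcoeff0.
have [e|ne] := eqVneq (mdeg m) d; first by rewrite sf ?e.
exact: dhomog_nemf_coeff hf ne.
Qed.

Lemma homog_msize_le d f : f \is d.-homog -> (msize f <= d.+1)%N.
Proof.
move=> hf; apply/msize_leP => m dm; apply: dhomog_nemf_coeff hf _.
by rewrite neq_ltn dm orbT.
Qed.

Lemma top_form_uniq d f F G : top_form d f F -> top_form d f G -> F = G.
Proof.
move=> [hF sF] [hG sG]; apply/eqP; rewrite -subr_eq0; apply/eqP.
apply: (@homog_msize_eq0 d); first by rewrite rpredB.
have -> : F - G = (f - G) - (f - F) by ring.
by rewrite (leq_trans (msizeD_le _ _)) // msizeN geq_max sG sF.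
Qed.

Lemma top_form_homog d f : f \is d.-homog -> top_form d f f.
Proof. by move=> hf; split=> //; rewrite subrr msize0. Qed.

Lemma top_form0 d f : top_form d f 0 -> (msize f <= d)%N.
Proof. by case=> _; rewrite subr0. Qed.

Lemma top_form_small d f : (msize f <= d)%N -> top_form d f 0.
Proof. by move=> sf; split; rewrite ?subr0 ?dhomog0. Qed.

Lemma top_formD d f F g G : top_form d f F -> top_form d g G ->
  top_form d (f + g) (F + G).
Proof.
move=> [hF sF] [hG sG]; split; first by rewrite rpredD.
rewrite opprD addrACA (leq_trans (msizeD_le _ _)) //.
by rewrite geq_max sG sF.
Qed.

Lemma top_formN d f F : top_form d f F -> top_form d (- f) (- F).
Proof. by move=> [hF sF]; split; rewrite ?rpredN // -opprD msizeN. Qed.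

Lemma top_formB d f F g G : top_form d f F -> top_form d g G ->
  top_form d (f - g) (F - G).
Proof. by move=> tf tg; apply: top_formD => //; apply: top_formN. Qed.

Lemma msizeM_lt f g d e : (msize f <= d)%N -> (msize g <= e.+1)%N ->
  (msize (f * g) <= d + e)%N.
Proof.
move=> sf sg; have [->|f0] := eqVneq f 0; first by rewrite mul0r msize0.
have [->|g0] := eqVneq g 0; first by rewrite mulr0 msize0.
rewrite msizeM // -ltnS prednK ?ltnS ?addn_gt0 ?lt0n ?msize_poly_eq0 ?f0 //.
by rewrite -addnS leq_add.
Qed.

Lemma top_formM d e f F g G : top_form d f F -> top_form e g G ->
  top_form (d + e) (f * g) (F * G).
Proof.
move=> [hF sF] [hG sG]; split; first exact: dhomogM.
have -> : f * g - F * G = (f - F) * G + F * (g - G) + (f - F) * (g - G) by ring.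
rewrite (leq_trans (msizeD_le _ _)) // geq_max.
rewrite (leq_trans (msizeD_le _ _)) ?geq_max.
  by rewrite msizeM_lt // (leq_trans sG).
rewrite msizeM_lt // ?homog_msize_le //=.
by rewrite mulrC addnC msizeM_lt // homog_msize_le.
Qed.

Lemma top_formZ d f F (c : K) : top_form d f F -> top_form d (c *: f) (c *: F).
Proof.
move=> [hF sF]; split; first exact: rpredZ.
by rewrite -scalerBr (leq_trans (msizeZ_le _ _)).
Qed.

Lemma top_form_mderiv d f F i : top_form d.+1 f F -> top_form d f^`M(i) F^`M(i).
Proof.
move=> [hF /msize_leP sF]; split.
  apply/dhomogP => m; rewrite mcoeff_msupp mcoeff_deriv => nz.
  apply/eqP; apply: contraNT nz => ne.
  have -> : F@_(m + U_(i)) = 0; last by rewrite mul0rn.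
  by apply: dhomog_nemf_coeff hF _; rewrite /= mdegD mdeg1 addn1.
apply/msize_leP => m dm; rewrite -mderivB mcoeff_deriv sF ?mul0rn //.
by rewrite mdegD mdeg1 addn1.
Qed.

Lemma euler_homog d f : f \is d.-homog -> \sum_i 'X_i * f^`M(i) = d%:R *: f.
Proof.
move=> hf; rewrite [in RHS](mpolyE f) scaler_sumr.
rewrite (eq_bigr (fun i => \sum_(m <- msupp f) (f@_m * (m i)%:R) *: 'X_[m])).
  rewrite exchange_big /= !big_seq; apply: eq_bigr => m mf.
  rewrite -scaler_suml -mulr_sumr -natr_sum -mdegE (dhomog_mf hf mf).
  by rewrite scalerA mulrC.
move=> i _; rewrite {1}(mpolyE f) linear_sum mulr_sumr /=; apply: eq_bigr => m _.
rewrite mderivZ mderivX scalerA -scalerAr -mpolyXD.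
have [->|m0] := eqVneq (m i) 0%N; first by rewrite mulr0 !scale0r.
by rewrite addmC submK // lep1mP.
Qed.
End Top.

(** * Linear maps compatible with the bracket *)

Lemma d3_mul (R : comNzRingType)
    (a0 a1 a2 b0 b1 b2 c0 c1 c2 x0 x1 x2 y0 y1 y2 z0 z1 z2 : R) :
  d3 (a0 * x0 + a1 * y0 + a2 * z0) (a0 * x1 + a1 * y1 + a2 * z1)
       (a0 * x2 + a1 * y2 + a2 * z2)
     (b0 * x0 + b1 * y0 + b2 * z0) (b0 * x1 + b1 * y1 + b2 * z1)
       (b0 * x2 + b1 * y2 + b2 * z2)
     (c0 * x0 + c1 * y0 + c2 * z0) (c0 * x1 + c1 * y1 + c2 * z1)
       (c0 * x2 + c1 * y2 + c2 * z2) =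
  d3 a0 a1 a2 b0 b1 b2 c0 c1 c2 * d3 x0 x1 x2 y0 y1 y2 z0 z1 z2.
Proof. rewrite /d3; ring. Qed.

(** The equation [{f, g} = h^2 - a f g] for linear forms [f], [g], [h]: the bracket
    of two linear forms is the determinant of their coefficients and the gradient
    of the cubic.  It is stated pointwise, so that only scalars occur below. *)
Definition hesse_linear (K : fieldType) (a f0 f1 f2 g0 g1 g2 h0 h1 h2 : K) :=
  forall x y z : K,
  d3 f0 f1 f2 g0 g1 g2
    (hesse_grad a x y z) (hesse_grad a y z x) (hesse_grad a z x y) =
  hesse_grad a (h0 * x + h1 * y + h2 * z) (f0 * x + f1 * y + f2 * z)
    (g0 * x + g1 * y + g2 * z).

Section Linear.
Variables (K : fieldType) (a : K).
Hypotheses (n2 : 2%:R != 0 :> K) (a31 : a ^+ 3 != 1).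
Variables (f0 f1 f2 g0 g1 g2 h0 h1 h2 : K).
Local Notation D := (d3 f0 f1 f2 g0 g1 g2 h0 h1 h2).
Hypothesis D0 : D != 0.
Local Notation grad := (hesse_grad a).
Local Notation f x y z := (f0 * x + f1 * y + f2 * z).
Local Notation g x y z := (g0 * x + g1 * y + g2 * z).
Local Notation h x y z := (h0 * x + h1 * y + h2 * z).

Hypothesis fgP : hesse_linear a f0 f1 f2 g0 g1 g2 h0 h1 h2.
Hypothesis ghP : hesse_linear a g0 g1 g2 h0 h1 h2 f0 f1 f2.
Hypothesis hfP : hesse_linear a h0 h1 h2 f0 f1 f2 g0 g1 g2.

(** The symmetric trilinear form with [tri v v v = 6 C(v)]. *)
Definition tri (u0 u1 u2 v0 v1 v2 w0 w1 w2 : K) : K :=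
  2%:R * (u0 * v0 * w0 + u1 * v1 * w1 + u2 * v2 * w2)
  - a * (u0 * v1 * w2 + u0 * v2 * w1 + u1 * v0 * w2 + u1 * v2 * w0
         + u2 * v0 * w1 + u2 * v1 * w0).

Lemma tri2 x y z w0 w1 w2 : tri x y z x y z w0 w1 w2 =
  2%:R * (grad x y z * w0 + grad y z x * w1 + grad z x y * w2).
Proof. rewrite /tri /hesse_grad; ring. Qed.

(** The equations express the gradient at the image point through the gradient
    at the point itself and the matrix of cofactors; pairing with a third vector
    turns the cofactors into the determinant. *)
Lemma tri_img x y z x' y' z' :
  tri (f x y z) (g x y z) (h x y z) (f x y z) (g x y z) (h x y z)
      (f x' y' z') (g x' y' z') (h x' y' z') = D * tri x y z x y z x' y' z'.
Proof. rewrite !tri2 -fgP -ghP -hfP /d3; ring. Qed.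

Lemma tri_polar u0 u1 u2 v0 v1 v2 w0 w1 w2 :
  2%:R * tri u0 u1 u2 v0 v1 v2 w0 w1 w2 =
  tri (u0 + v0) (u1 + v1) (u2 + v2) (u0 + v0) (u1 + v1) (u2 + v2) w0 w1 w2
  - tri u0 u1 u2 u0 u1 u2 w0 w1 w2 - tri v0 v1 v2 v0 v1 v2 w0 w1 w2.
Proof. rewrite /tri; ring. Qed.

(** By polarization, as 2 is invertible. *)
Lemma tri_img3 x y z x' y' z' x'' y'' z'' :
  tri (f x y z) (g x y z) (h x y z) (f x' y' z') (g x' y' z') (h x' y' z')
      (f x'' y'' z'') (g x'' y'' z'') (h x'' y'' z'')
  = D * tri x y z x' y' z' x'' y'' z''.
Proof.
apply: (mulfI n2); have DB u v w : D * (u - v - w) = D * u - D * v - D * w by ring.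
rewrite [RHS]mulrCA !tri_polar DB -!tri_img.
congr (tri _ _ _ _ _ _ _ _ _ - _ - _); ring.
Qed.

(** The Hessian determinant of [C]: the entries of the matrix are the values
    [tri e_i e_j (x, y, z)] on the standard basis. *)
Definition hess (x y z : K) : K :=
  d3 (2%:R * x) (- a * z) (- a * y) (- a * z) (2%:R * y) (- a * x)
     (- a * y) (- a * x) (2%:R * z).

(** The Hessian matrix [N'] at the image point satisfies [M^T N' M = D N] for the
    matrix [M] of the map and the Hessian matrix [N] at the point, by
    [tri_img3]; the determinants give [D^2 det N' = D^3 det N]. *)
Lemma hess_img x y z : hess (f x y z) (g x y z) (h x y z) = D * hess x y z.
Proof.
have D20 : D ^+ 2 != 0 by rewrite expf_neq0.
apply: (mulfI D20).
pose t u0 u1 u2 v0 v1 v2 := tri u0 u1 u2 v0 v1 v2 (f x y z) (g x y z) (h x y z).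
transitivity (d3 (t f0 g0 h0 f0 g0 h0) (t f0 g0 h0 f1 g1 h1) (t f0 g0 h0 f2 g2 h2)
    (t f1 g1 h1 f0 g0 h0) (t f1 g1 h1 f1 g1 h1) (t f1 g1 h1 f2 g2 h2)
    (t f2 g2 h2 f0 g0 h0) (t f2 g2 h2 f1 g1 h1) (t f2 g2 h2 f2 g2 h2)).
  transitivity (d3 f0 g0 h0 f1 g1 h1 f2 g2 h2 * (hess (f x y z) (g x y z) (h x y z) * D)).
    rewrite [d3 f0 g0 _ _ _ _ _ _ _](_ : _ = D); last by rewrite /d3; ring.
    by ring.
  rewrite /hess -!d3_mul; congr (d3 _ _ _ _ _ _ _ _ _); rewrite /t /tri; ring.
have img u0 u1 u2 v0 v1 v2 :
    t (f u0 u1 u2) (g u0 u1 u2) (h u0 u1 u2) (f v0 v1 v2) (g v0 v1 v2) (h v0 v1 v2)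
    = D * tri u0 u1 u2 v0 v1 v2 x y z by exact: tri_img3.
have e0 (u0 u1 u2 : K) : u0 * 1 + u1 * 0 + u2 * 0 = u0 by ring.
have e1 (u0 u1 u2 : K) : u0 * 0 + u1 * 1 + u2 * 0 = u1 by ring.
have e2 (u0 u1 u2 : K) : u0 * 0 + u1 * 0 + u2 * 1 = u2 by ring.
have := (img 1 0 0 1 0 0, img 1 0 0 0 1 0, img 1 0 0 0 0 1,
  (img 0 1 0 1 0 0, img 0 1 0 0 1 0, img 0 1 0 0 0 1),
  (img 0 0 1 1 0 0, img 0 0 1 0 1 0, img 0 0 1 0 0 1)).
rewrite !e0 !e1 !e2 => -[[E0 E1] E2]; rewrite !E0 !E1 !E2 /hess /tri.
move: D => k; rewrite /d3; ring.
Qed.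

(** [C] and its Hessian are both multiplied by [D]; for [a^3 <> 1] the product
    of the variables is a combination of the two. *)
Lemma prod_img x y z : f x y z * g x y z * h x y z = D * (x * y * z).
Proof.
have hessE u v w : hess u v w =
    (8%:R - 2%:R * a ^+ 3) * (u * v * w) - 2%:R * a ^+ 2 * (u ^+ 3 + v ^+ 3 + w ^+ 3).
  by rewrite /hess /d3; ring.
have cub u v w : tri u v w u v w u v w =
    2%:R * (u ^+ 3 + v ^+ 3 + w ^+ 3) - 6%:R * a * (u * v * w).
  by rewrite /tri; ring.
have n8 : 8%:R * (1 - a ^+ 3) != 0.
  have -> : 8%:R = 2%:R ^+ 3 :> K by ring.
  by rewrite mulf_neq0 ?expf_neq0 // subr_eq0 eq_sym.
apply: (mulfI n8).
have e1 := hess_img x y z; have e2 := tri_img x y z x y z.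
rewrite !hessE in e1; rewrite !cub in e2.
move: (f x y z) (g x y z) (h x y z) e1 e2 => u v w e1 e2.
transitivity (hess u v w + a ^+ 2 * tri u v w u v w u v w).
  by rewrite hessE cub; ring.
by rewrite hessE cub e1 e2; ring.
Qed.

(** The coefficients of the three squares in [{f, g} = h^2 - a f g]. *)
Lemma img_coef :
  [/\ f1 * g2 - f2 * g1 = h0 ^+ 2 - a * (f0 * g0),
      f2 * g0 - f0 * g2 = h1 ^+ 2 - a * (f1 * g1)
    & f0 * g1 - f1 * g0 = h2 ^+ 2 - a * (f2 * g2)].
Proof.
have tr (u v u' v' : K) : u = v -> u' = u -> v = v' -> u' = v' by move=> -> -> ->.
by split; [apply: (tr _ _ _ _ (fgP 1 0 0)) | apply: (tr _ _ _ _ (fgP 0 1 0))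
  | apply: (tr _ _ _ _ (fgP 0 0 1))]; rewrite /d3 /hesse_grad; ring.
Qed.
End Linear.

(** A product of three binary linear forms that vanishes identically has a zero
    factor; four points decide it when 2 is invertible. *)
Lemma three_lines (K : fieldType) (n2 : 2%:R != 0 :> K) (a0 a1 b0 b1 c0 c1 : K) :
  (forall s t, (a0 * s + a1 * t) * (b0 * s + b1 * t) * (c0 * s + c1 * t) = 0) ->
  [\/ a0 = 0 /\ a1 = 0, b0 = 0 /\ b1 = 0 | c0 = 0 /\ c1 = 0].
Proof.
move=> e.
have e0 : a0 * b0 * c0 = 0 by rewrite -(e 1 0); ring.
have e3 : a1 * b1 * c1 = 0 by rewrite -(e 0 1); ring.
have e1 : a0 * b0 * c1 + a0 * b1 * c0 + a1 * b0 * c0 = 0.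
  apply: (mulfI n2); rewrite mulr0.
  transitivity (0 + 0 - 2%:R * (a1 * b1 * c1)); last by rewrite e3; ring.
  by rewrite -{1}(e 1 1) -(e (-1) 1); ring.
have e2 : a1 * b1 * c0 + a1 * b0 * c1 + a0 * b1 * c1 = 0.
  apply: (mulfI n2); rewrite mulr0.
  transitivity (0 - 0 - 2%:R * (a0 * b0 * c0)); last by rewrite e0; ring.
  by rewrite -{1}(e 1 1) -(e (-1) 1); ring.
have z (u v w : K) : u * v * w = 0 -> [\/ u = 0, v = 0 | w = 0].
  move/eqP; rewrite !mulf_eq0 -orbA => /or3P[] /eqP->; by constructor.
move: (z _ _ _ e0) (z _ _ _ e3) e1 e2 => {e e0 e3}.
case=> -> [] ->; rewrite ?(mulr0, mul0r, addr0, add0r) => e1 e2.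
all: try by constructor.
all: try case: (z _ _ _ e1) => u0; try case: (z _ _ _ e2) => v0.
all: try by [constructor 1 | constructor 2 | constructor 3].
Qed.

Lemma squares_cube_root (K : fieldType) (p q r : K) : p != 0 ->
  p ^+ 2 = q * r -> q ^+ 2 = r * p -> r ^+ 2 = p * q ->
  exists2 w, w ^+ 3 = 1 & q = p * w /\ r = p * w ^+ 2.
Proof.
move=> p0 pE qE rE; exists (q / p); last split.
- rewrite expr_div_n exprS qE mulrA -pE -exprSr mulfV // expf_neq0 //.
- by rewrite mulrCA mulfV // mulr1.
- by rewrite expr_div_n qE; field.
Qed.

(** By [prod_img] the product of the three forms vanishes on each coordinate
    line of the triangle, so for any two variables one of the forms involves
    neither; a form cannot do this for two pairs, as the determinant is not
    zero.  Hence the map is monomial, and [img_coef] says that the square of each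
    coefficient is plus or minus the product of the other two, with the sign of
    the permutation.  The sign minus would give [2 (p q r)^2 = 0]. *)
Lemma hesse_linearP (K : fieldType) (a f0 f1 f2 g0 g1 g2 h0 h1 h2 : K) :
  2%:R != 0 :> K -> a ^+ 3 != 1 ->
  d3 f0 f1 f2 g0 g1 g2 h0 h1 h2 != 0 ->
  hesse_linear a f0 f1 f2 g0 g1 g2 h0 h1 h2 ->
  hesse_linear a g0 g1 g2 h0 h1 h2 f0 f1 f2 ->
  hesse_linear a h0 h1 h2 f0 f1 f2 g0 g1 g2 ->
  exists p w, [/\ p != 0, w ^+ 3 = 1 &
    [\/ (f0, f1, f2, (g0, g1, g2), (h0, h1, h2)) =
        (p, 0, 0, (0, p * w, 0), (0, 0, p * w ^+ 2)),
        (f0, f1, f2, (g0, g1, g2), (h0, h1, h2)) =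
        (0, p, 0, (0, 0, p * w), (p * w ^+ 2, 0, 0)) |
        (f0, f1, f2, (g0, g1, g2), (h0, h1, h2)) =
        (0, 0, p, (p * w, 0, 0), (0, p * w ^+ 2, 0))]].
Proof.
move=> n2 a31 D0 fg gh hf.
have lines := prod_img n2 a31 D0 fg gh hf.
have [e0 e1 e2] := img_coef fg.
have [e3 e4 e5] := img_coef gh.
have [e6 e7 e8] := img_coef hf.
have L01 : [\/ f0 = 0 /\ f1 = 0, g0 = 0 /\ g1 = 0 | h0 = 0 /\ h1 = 0].
  apply: (three_lines n2) => s t; have := lines s t 0.
  by rewrite !mulr0 !addr0.
have L02 : [\/ f0 = 0 /\ f2 = 0, g0 = 0 /\ g2 = 0 | h0 = 0 /\ h2 = 0].
  apply: (three_lines n2) => s t; have := lines s 0 t.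
  by rewrite !mulr0 !addr0 !mul0r mulr0.
have L12 : [\/ f1 = 0 /\ f2 = 0, g1 = 0 /\ g2 = 0 | h1 = 0 /\ h2 = 0].
  apply: (three_lines n2) => s t; have := lines 0 s t.
  by rewrite !mulr0 !add0r !mul0r mulr0.
clear lines fg gh hf.
have odd (p q r : K) : p * (q * r) != 0 -> - (p * q) = r ^+ 2 ->
    - (q * r) = p ^+ 2 -> - (r * p) = q ^+ 2 -> False.
  move=> nz rE pE qE; have : 2%:R * (p * (q * r)) ^+ 2 = 0.
    transitivity ((p * (q * r)) ^+ 2 + p ^+ 2 * q ^+ 2 * r ^+ 2); first by ring.
    by rewrite -pE -qE -rE; ring.
  by move/eqP; rewrite mulf_eq0 (negPf n2) expf_eq0 (negPf nz).
have even (p q r : K) : p * (q * r) != 0 -> p * q = r ^+ 2 ->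
    q * r = p ^+ 2 -> r * p = q ^+ 2 ->
    exists w, [/\ p != 0, w ^+ 3 = 1, q = p * w & r = p * w ^+ 2].
  rewrite mulf_eq0 negb_or => /andP[p0 _] rE pE qE.
  have [w w3 [qw rw]] := squares_cube_root p0 (esym pE) (esym qE) (esym rE).
  by exists w.
(* 27 choices, of which the 6 permutations have a nonzero determinant *)
case: L01 => -[? ?]; subst; case: L02 => -[? ?]; subst; case: L12 => -[? ?]; subst.
all: try by move: D0; rewrite /d3 ?(mulr0, mul0r, subr0, addr0) eqxx.
all: try (exfalso; move: D0; rewrite /d3 => D0; apply: (negP D0); apply/eqP; ring).
all: move: D0 e0 e1 e2 e3 e4 e5 e6 e7 e8.
all: rewrite /d3 !(mulr0, mul0r, subr0, addr0, add0r, sub0r, expr0n, oppr0) /=.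
all: rewrite ?(mulrN, opprK, oppr_eq0) => nz *.
- by exfalso; apply: (odd f2 g1 h0).
- have [||||w [p0 w3 -> ->]] := even f2 g0 h1 => //.
  by exists f2, w; split=> //; constructor 3.
- have [||||w [p0 w3 -> ->]] := even f1 g2 h0 => //.
  by exists f1, w; split=> //; constructor 2.
- by exfalso; apply: (odd f0 g2 h1).
- by exfalso; apply: (odd f1 g0 h2).
- have [||||w [p0 w3 -> ->]] := even f0 g1 h2 => //.
  by exists f0, w; split=> //; constructor 1.
Qed.

(** * The chain rule for Jacobians *)

Lemma sum_ord3 (V : nmodType) (F : 'I_3 -> V) : \sum_(i < 3) F i = F 0 + F 1 + F 2.
Proof.
rewrite !big_ord_recl big_ord0 addr0 addrA.
by congr (_ + F _ + F _); apply: val_inj.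
Qed.

Lemma rmorph_d3 (R S : comNzRingType) (T : {rmorphism R -> S})
    (a0 a1 a2 b0 b1 b2 c0 c1 c2 : R) :
  T (d3 a0 a1 a2 b0 b1 b2 c0 c1 c2) =
  d3 (T a0) (T a1) (T a2) (T b0) (T b1) (T b2) (T c0) (T c1) (T c2).
Proof. by rewrite /d3 !(rmorphD, rmorphN, rmorphM). Qed.

Section Chain.
Variable K : fieldType.
Local Notation A := {mpoly K[3]}.
Implicit Types (u v w f g h : A).

Lemma mderiv_comp_mpoly (t : 3.-tuple A) u i :
  (u \mPo t)^`M(i) = \sum_(j < 3) (u^`M(j) \mPo t) * (t`_j)^`M(i).
Proof.
move: u; apply: mpoly_gen_ind => [|c u v eu ev|u v eu ev|k].
- by rewrite comp_mpoly1 -[1]/(1%:MP) mderivC big1 // => j _;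
    rewrite mderivC comp_mpoly0 mul0r.
- rewrite comp_mpolyD comp_mpolyZ mderivD mderivZ eu ev scaler_sumr -big_split.
  by apply: eq_bigr => j _; rewrite mderivD mderivZ comp_mpolyD comp_mpolyZ mulrDl scalerAl.
- rewrite rmorphM mderivM eu ev mulr_suml mulr_sumr -big_split /=.
  apply: eq_bigr => j _; rewrite mderivM rmorphD !rmorphM /=; ring.
- rewrite comp_mpolyXU (bigD1 k) //= big1 ?addr0 => [|j ne].
    by rewrite mderivU eqxx comp_mpoly1 mul1r.
  by rewrite mderivU eq_sym (negPf ne) comp_mpoly0 mul0r.
Qed.

(** The Jacobian matrix of a composition is a product of Jacobian matrices. *)
Lemma jacobian3_comp_mpoly (t : 3.-tuple A) u v w :
  jacobian3 (u \mPo t) (v \mPo t) (w \mPo t) =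
  (jacobian3 u v w \mPo t) * jacobian3 t`_0 t`_1 t`_2.
Proof.
by rewrite !jacobian3E !mderiv_comp_mpoly !sum_ord3 rmorph_d3 -d3_mul.
Qed.

Lemma msize_inv u v : u * v = 1 -> exists2 c : K, c != 0 & u = c%:MP.
Proof.
move=> uv; have u0 : u != 0.
  by apply: contraPneq uv => ->; rewrite mul0r => /eqP; rewrite eq_sym oner_eq0.
have v0 : v != 0.
  by apply: contraPneq uv => ->; rewrite mulr0 => /eqP; rewrite eq_sym oner_eq0.
apply/msize_poly1P; rewrite eqn_leq lt0n msize_poly_eq0 u0 andbT.
have := msizeM u0 v0; rewrite uv msize1 => e.
have : (0 < msize v)%N by rewrite lt0n msize_poly_eq0.
by case: (msize u) (msize v) e => [|[|n]] [|m] //=; rewrite addSn addnS.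
Qed.

Lemma d3_top_form d1 d2 d3' (a0 a1 a2 b0 b1 b2 c0 c1 c2 : A)
    (A0 A1 A2 B0 B1 B2 C0 C1 C2 : A) :
  top_form d1 a0 A0 -> top_form d1 a1 A1 -> top_form d1 a2 A2 ->
  top_form d2 b0 B0 -> top_form d2 b1 B1 -> top_form d2 b2 B2 ->
  top_form d3' c0 C0 -> top_form d3' c1 C1 -> top_form d3' c2 C2 ->
  top_form (d1 + (d2 + d3')) (d3 a0 a1 a2 b0 b1 b2 c0 c1 c2)
    (d3 A0 A1 A2 B0 B1 B2 C0 C1 C2).
Proof.
move=> ? ? ? ? ? ? ? ? ?; rewrite /d3.
apply: top_formD; first apply: top_formB.
all: by apply: top_formM => //; apply: top_formB; apply: top_formM.
Qed.
End Chain.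

(** * Solutions of the bracket equations *)

Section Triple.
Variables (K : fieldType) (alpha : K).
Hypotheses (n3 : 3%:R != 0 :> K) (a31 : alpha ^+ 3 != 1).
Local Notation A := {mpoly K[3]}.
Local Notation E := (elliptic alpha).
Implicit Types (u v w f g h : A).
Local Notation grad := (hesse_grad (alpha%:MP : A)).
Local Notation x := (ell_x K).
Local Notation y := (ell_y K).
Local Notation z := (ell_z K).
Local Notation C := (ell_C alpha).

Lemma mderivCE : [/\ C^`M(0) = grad x y z, C^`M(1) = grad y z x & C^`M(2) = grad z x y].
Proof.
rewrite mderivC0 mderivC1 mderivC2 mulVf // !scale1r /hesse_grad !mul_mpolyC.
by rewrite [z * x]mulrC.
Qed.

(** Exactly the condition for [x |-> f], [y |-> g], [z |-> h] to respect the
    brackets of the variables. *)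
Definition poisson_triple f g h :=
  [/\ jacobian3 f g C = grad h f g, jacobian3 g h C = grad f g h
    & jacobian3 h f C = grad g h f].

(** Both sides of each equation have degree at most [2 (d + 1)]; the equations for
    the forms are the comparison in that degree. *)
Lemma poisson_triple_top d f g h F G H :
  top_form d.+1 f F -> top_form d.+1 g G -> top_form d.+1 h H ->
  poisson_triple f g h -> poisson_triple F G H.
Proof.
have hx (i : 'I_3) : top_form 1 'X_i ('X_i : A).
  by apply: top_form_homog; rewrite dhomogX /= mdeg1.
have tgrad e f1 g1 h1 F1 G1 H1 : top_form e f1 F1 -> top_form e g1 G1 -> top_form e h1 H1 ->
    top_form (e + e) (grad f1 g1 h1) (grad F1 G1 H1).
  move=> tf tg th; rewrite /hesse_grad !mul_mpolyC.
  by apply: top_formB; [apply: top_formM | apply: top_formZ; apply: top_formM].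
have tjac f1 g1 F1 G1 : top_form d.+1 f1 F1 -> top_form d.+1 g1 G1 ->
    top_form (d.+1 + d.+1) (jacobian3 f1 g1 C) (jacobian3 F1 G1 C).
  move=> tf tg; rewrite !jacobian3E; have [-> -> ->] := mderivCE.
  have -> : (d.+1 + d.+1 = d + (d + (1 + 1)))%N by rewrite !addnS addn0.
  apply: d3_top_form; first [exact: top_form_mderiv
    | exact: (tgrad 1%N _ _ _ _ _ _ (hx _) (hx _) (hx _))].
move=> tf tg th [e1 e2 e3]; split.
- by apply: (top_form_uniq (tjac _ _ _ _ tf tg)); rewrite e1; apply: tgrad.
- by apply: (top_form_uniq (tjac _ _ _ _ tg th)); rewrite e2; apply: tgrad.
- by apply: (top_form_uniq (tjac _ _ _ _ th tf)); rewrite e3; apply: tgrad.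
Qed.

Lemma euler3 d f : f \is d.-homog ->
  x * f^`M(0) + y * f^`M(1) + z * f^`M(2) = d%:R *: f.
Proof. by move/euler_homog <-; rewrite sum_ord3. Qed.

(** By the equations the left side is [d (F {G, H} + G {H, F} + H {F, G})],
    and for [F], [G], [H] obtained from their gradients by Euler's identity
    Cramer's rule evaluates it.  Up to the factor 3 this reads
    [d C(F, G, H) = J(F, G, H) C]. *)
Lemma poisson_triple_cubic d F G H :
  F \is d.-homog -> G \is d.-homog -> H \is d.-homog ->
  poisson_triple F G H ->
  d%:R *: (F ^+ 3 + G ^+ 3 + H ^+ 3 - 3%:R * alpha%:MP * (F * G * H)) =
  jacobian3 F G H * (x ^+ 3 + y ^+ 3 + z ^+ 3 - 3%:R * alpha%:MP * (x * y * z)).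
Proof.
move=> hF hG hH [e1 e2 e3].
transitivity (d%:R *: F * grad F G H + d%:R *: G * grad G H F + d%:R *: H * grad H F G).
  by rewrite -!scalerAl -!scalerDr; congr (_ *: _); rewrite /hesse_grad; ring.
rewrite -e1 -e2 -e3 -(euler3 hF) -(euler3 hG) -(euler3 hH) !jacobian3E.
have [-> -> ->] := mderivCE; rewrite /hesse_grad /d3.
ring.
Qed.

Lemma poisson_tripleC f g h : poisson_triple f g h -> poisson_triple g h f.
Proof. by case. Qed.

Lemma jacobian3C f g h : jacobian3 f g h = jacobian3 g h f.
Proof. by rewrite !jacobian3E /d3; ring. Qed.

Lemma poisson_triple_eq0 f g h : poisson_triple f g h ->
  jacobian3 f g C = 0 -> jacobian3 g h C = 0 -> jacobian3 h f C = 0 -> f = 0.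
Proof.
move=> [-> -> ->] e1 e2 e3; apply: hesse_grad_eq0 e2 e3 e1.
by rewrite -rmorphXn -[1]/(1%:MP) mpolyC_eq.
Qed.

Lemma jacobian3_parallel f g : (forall i, f * g^`M(i) = g * f^`M(i)) ->
  jacobian3 f g C = 0.
Proof.
move=> e; rewrite jacobian3E; have [->|f0] := eqVneq f 0.
  by rewrite !mderiv0 /d3; ring.
apply: (mulfI f0); rewrite mulr0.
transitivity (d3 f^`M(0) f^`M(1) f^`M(2) (f * g^`M(0)) (f * g^`M(1)) (f * g^`M(2))
  C^`M(0) C^`M(1) C^`M(2)); first by rewrite /d3; ring.
by rewrite !e /d3; ring.
Qed.

(** The triple lies on the cubic by [poisson_triple_cubic]; so it has constant
    ratios and zero brackets, and the gradient of [C] vanishes at it. *)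
Lemma homog_triple_eq0 d F G H : d%:R != 0 :> K ->
  F \is d.-homog -> G \is d.-homog -> H \is d.-homog ->
  poisson_triple F G H -> jacobian3 F G H = 0 -> F = 0.
Proof.
move=> d0 hF hG hH tr J0.
have curve : F ^+ 3 + G ^+ 3 + H ^+ 3 = 3%:R * alpha%:MP * (F * G * H).
  have := poisson_triple_cubic hF hG hH tr; rewrite J0 mul0r => /eqP.
  by rewrite scaler_eq0 (negPf d0) subr_eq0 => /eqP.
have curve' : G ^+ 3 + H ^+ 3 + F ^+ 3 = 3%:R * alpha%:MP * (G * H * F).
  by rewrite addrC addrA curve; ring.
have curve'' : H ^+ 3 + F ^+ 3 + G ^+ 3 = 3%:R * alpha%:MP * (H * F * G).
  by rewrite addrC addrA curve'; ring.
apply: (poisson_triple_eq0 tr); apply: jacobian3_parallel => i.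
- exact: hesse_curve_mderiv curve.
- exact: hesse_curve_mderiv curve'.
- exact: hesse_curve_mderiv curve''.
Qed.

(** If the largest degree were [d + 2], the Jacobian of the forms of that degree
    would vanish, being the part of degree [3 (d + 1) > 0] of a constant; then
    these forms would all be zero. *)
Lemma poisson_triple_msize f g h (c : K) : [pchar K] =i pred0 -> c != 0 ->
  poisson_triple f g h -> jacobian3 f g h = c%:MP ->
  [/\ (msize f <= 2)%N, (msize g <= 2)%N & (msize h <= 2)%N].
Proof.
move=> char0 c0 tr J.
pose n := maxn (msize f) (maxn (msize g) (msize h)).
have sf : (msize f <= n)%N by rewrite leq_maxl.
have sg : (msize g <= n)%N by rewrite /n maxnCA leq_maxl.
have sh : (msize h <= n)%N by rewrite /n !leq_max leqnn !orbT.
have [n2|n2] := leqP n 2.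
  by split; [apply: leq_trans n2 | apply: leq_trans n2 | apply: leq_trans n2].
have [d nE] : exists d, n = d.+3 by case: (n) n2 => [|[|[|d]]] // _; exists d.
rewrite nE in sf sg sh.
have [F tF] : exists F, top_form d.+2 f F by eexists; apply: top_form_pihomog.
have [G tG] : exists G, top_form d.+2 g G by eexists; apply: top_form_pihomog.
have [H tH] : exists H, top_form d.+2 h H by eexists; apply: top_form_pihomog.
have trT := poisson_triple_top tF tG tH tr.
have J0 : jacobian3 F G H = 0.
  have tJ : top_form (d.+1 + (d.+1 + d.+1)) (jacobian3 f g h) (jacobian3 F G H).
    by rewrite !jacobian3E; apply: d3_top_form; apply: top_form_mderiv.
  apply: top_form_uniq tJ _; apply: top_form_small.
  by rewrite J msizeC; case: (c != 0).
have d0 : d.+2%:R != 0 :> K by move/pcharf0P: char0 => ->.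
have [hF _] := tF; have [hG _] := tG; have [hH _] := tH.
have F0 := homog_triple_eq0 d0 hF hG hH trT J0.
have G0 : G = 0.
  apply: (homog_triple_eq0 d0 hG hH hF (poisson_tripleC trT)).
  by rewrite -jacobian3C.
have H0 : H = 0.
  apply: (homog_triple_eq0 d0 hH hF hG (poisson_tripleC (poisson_tripleC trT))).
  by rewrite -jacobian3C -jacobian3C.
move: tF tG tH; rewrite F0 G0 H0 => /top_form0 tF /top_form0 tG /top_form0 tH.
have : (n <= d.+2)%N by rewrite /n !geq_max tF tG tH.
by rewrite nE ltnn.
Qed.

Lemma eval0_bracket f g : (jacobian3 f g C).@[fun => 0] = 0.
Proof.
rewrite jacobian3E; have [-> -> ->] := mderivCE.
rewrite /d3 /hesse_grad !(mevalD, mevalN, mevalM, mevalC, rmorphXn, mevalXU).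
ring.
Qed.

(** All brackets vanish at the origin, so the gradient of [C] is zero at the point
    [(f(0), g(0), h(0))]; by smoothness that point is the origin. *)
Lemma poisson_triple_homog1 f g h : poisson_triple f g h ->
  (msize f <= 2)%N -> (msize g <= 2)%N -> (msize h <= 2)%N -> f \is 1.-homog.
Proof.
move=> [e1 e2 e3] sf sg sh.
have ev u v w : (grad u v w).@[fun => 0] =
    hesse_grad alpha u.@[fun => 0] v.@[fun => 0] w.@[fun => 0].
  by rewrite /hesse_grad !expr2 mevalB !mevalM mevalC.
have [hF sF] := top_form_pihomog sf; set F := pihomog _ _ _ in hF sF.
have f0 : f.@[fun => 0] = 0.
  by apply: (@hesse_grad_eq0 _ alpha _ g.@[fun => 0] h.@[fun => 0] a31);
    rewrite -ev -?e1 -?e2 -?e3 eval0_bracket.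
have F0 : F.@[fun => 0] = 0.
  have := euler3 hF; rewrite scale1r => <-.
  by rewrite !mevalD !mevalM !mevalXU !mul0r !addr0.
have fE : f = F.
  have e := msize1_polyC sF; apply/eqP; rewrite -subr_eq0 e.
  have := congr1 (meval (fun => 0)) e.
  by rewrite mevalB mevalC f0 F0 subrr mpolyC_eq0 => <-.
by rewrite fE.
Qed.

Lemma linear_form f : f \is 1.-homog -> exists a b c : K,
  f = a%:MP * x + b%:MP * y + c%:MP * z.
Proof.
move=> hf; have := euler3 hf; rewrite scale1r => <-.
have cst i : exists c : K, f^`M(i) = c%:MP.
  exists (f^`M(i))@_0; apply: msize1_polyC; apply: homog_msize_le.
  by have [] := top_form_mderiv i (top_form_homog hf).
have [a ->] := cst 0; have [b ->] := cst 1; have [c ->] := cst 2.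
by exists a, b, c; ring.
Qed.
End Triple.

(** * The images of the variables under an automorphism *)

Section Images.
Variables (K : fieldType) (alpha : K).
Local Notation A := {mpoly K[3]}.
Local Notation E := (elliptic alpha).
Local Notation x := (ell_x K).
Local Notation y := (ell_y K).
Local Notation z := (ell_z K).
Implicit Types phi psi : pAut E.

Lemma paut1 phi : phi 1 = 1.
Proof.
have [[inv _ invK] _ pM _] := pAutP phi.
by rewrite -[LHS]mulr1 -{2}[1](invK 1) -pM mul1r invK.
Qed.

Lemma pautD phi u v : phi (u + v) = phi u + phi v.
Proof. by have [_ pL _ _] := pAutP phi; have := pL 1 u v; rewrite !scale1r. Qed.

Lemma pautZ phi (c : K) u : phi (c *: u) = c *: phi u.
Proof.
have [_ pL _ _] := pAutP phi; apply: (addIr (phi u)).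
by rewrite -pL pautD.
Qed.

Lemma pautM phi u v : phi (u * v) = phi u * phi v.
Proof. by have [_ _ pM _] := pAutP phi; rewrite pM. Qed.

Lemma paut_gen_eq phi psi :
  (forall i : 'I_3, phi ('X_i : A) = psi ('X_i : A)) -> phi = psi.
Proof.
move=> e; apply: pAut_eq; apply: mpoly_gen_ind => [|c u v eu ev|u v eu ev|i].
- by rewrite !paut1.
- by rewrite !pautD !pautZ eu ev.
- by rewrite !pautM eu ev.
- exact: e.
Qed.

Lemma pautE phi (u : A) :
  phi u = (u \mPo [tuple phi x : A; phi y : A; phi z : A]) :> A.
Proof.
move: u; apply: mpoly_gen_ind => [|c u v eu ev|u v eu ev|i].
- by rewrite paut1 comp_mpoly1.
- by rewrite pautD pautZ eu ev comp_mpolyD comp_mpolyZ.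
- by rewrite pautM eu ev rmorphM.
- rewrite comp_mpolyXU; move: i; exact: ord3_case.
Qed.

(** Apply the chain rule to the preimages of [x], [y], [z]: the Jacobian is a
    unit of the polynomial ring. *)
Lemma paut_jacobian phi : exists2 c : K, c != 0 &
  jacobian3 (phi x : A) (phi y : A) (phi z : A) = c%:MP.
Proof.
have [[inv _ invK] _ _ _] := pAutP phi.
set t := [tuple phi x : A; phi y : A; phi z : A].
have J1 : jacobian3 x y z = 1 :> A by rewrite jacobian3E /d3 !mderivU /=; ring.
have := jacobian3_comp_mpoly t (inv x) (inv y) (inv z).
rewrite -!pautE !invK J1 mulrC => /esym; exact: msize_inv.
Qed.

Lemma paut_triple phi : 3%:R != 0 :> K ->
  poisson_triple alpha (phi x : A) (phi y : A) (phi z : A).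
Proof.
move=> n3; have [_ _ _ pB] := pAutP phi.
have grad (u v w : A) :
    phi (- alpha *: (u * v) + w ^+ 2 : A) = hesse_grad alpha%:MP (phi w : A) (phi u) (phi v).
  by rewrite pautD pautZ expr2 !pautM /hesse_grad mul_mpolyC scaleNr addrC -expr2.
by split; [rewrite -grad -(bracket_xy alpha n3) pB
  | rewrite -grad -(bracket_yz alpha n3) pB | rewrite -grad -(bracket_zx alpha n3) pB].
Qed.

(** Up to the scalar [p], which accounts for some [phi_p], and the cube root of
    unity [w], which accounts for some power of [sigma], the variables are
    permuted cyclically. *)
Lemma paut_images phi : [pchar K] =i pred0 -> alpha ^+ 3 != 1 ->
  exists p w, [/\ p != 0, w ^+ 3 = 1 &
    exists2 t : 3.-tuple A,
      t = [tuple x; y; z] \/ t = [tuple y; z; x] \/ t = [tuple z; x; y] &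
      [/\ phi x = p *: (t`_0 : E), phi y = (p * w) *: (t`_1 : E)
        & phi z = (p * w ^+ 2) *: (t`_2 : E)]].
Proof.
move=> char0 a31.
have n2 : 2%:R != 0 :> K by move/pcharf0P: char0 => ->.
have n3 : 3%:R != 0 :> K by move/pcharf0P: char0 => ->.
have tr := paut_triple phi n3; have [c c0 J] := paut_jacobian phi.
have [sf sg sh] := poisson_triple_msize n3 a31 char0 c0 tr J.
have tr' := poisson_tripleC tr; have tr'' := poisson_tripleC tr'.
have hf := poisson_triple_homog1 n3 a31 tr sf sg sh.
have hg := poisson_triple_homog1 n3 a31 tr' sg sh sf.
have hh := poisson_triple_homog1 n3 a31 tr'' sh sf sg.
have [f0 [f1 [f2 fE]]] := linear_form hf.
have [g0 [g1 [g2 gE]]] := linear_form hg.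
have [h0 [h1 [h2 hE]]] := linear_form hh.
rewrite fE gE hE in tr J *.
have dl (a0 a1 a2 : K) (u := a0%:MP * x + a1%:MP * y + a2%:MP * z) :
    [/\ u^`M(0) = a0%:MP, u^`M(1) = a1%:MP & u^`M(2) = a2%:MP].
  by rewrite /u !mderivD !mderiv_mulC !mderivU /=
    !(mulr0, mulr1, addr0, add0r).
have D0 : d3 f0 f1 f2 g0 g1 g2 h0 h1 h2 != 0.
  apply: contraNneq c0 => D; rewrite -(mpolyC_eq0 3) -J jacobian3E.
  have [-> -> ->] := dl f0 f1 f2; have [-> -> ->] := dl g0 g1 g2.
  by have [-> -> ->] := dl h0 h1 h2; rewrite -rmorph_d3 D rmorph0.
have lin a0 a1 a2 b0 b1 b2 c0' c1 c2 :
    jacobian3 (a0%:MP * x + a1%:MP * y + a2%:MP * z)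
      (b0%:MP * x + b1%:MP * y + b2%:MP * z) (ell_C alpha) =
    hesse_grad alpha%:MP (c0'%:MP * x + c1%:MP * y + c2%:MP * z)
      (a0%:MP * x + a1%:MP * y + a2%:MP * z) (b0%:MP * x + b1%:MP * y + b2%:MP * z) ->
    hesse_linear alpha a0 a1 a2 b0 b1 b2 c0' c1 c2.
  move=> e u v w; move: e; rewrite jacobian3E.
  have [-> -> ->] := dl a0 a1 a2; have [-> -> ->] := dl b0 b1 b2.
  have [-> -> ->] := mderivCE alpha n3.
  move/(congr1 (meval (fun i => tnth [tuple u; v; w] i))).
  rewrite /d3 /hesse_grad !expr2 !(mevalD, mevalN, mevalM, mevalC, mevalXU).
  rewrite !(tnth_nth 0) /= => ->; ring.
have [e1 e2 e3] := tr.
have [p [w [p0 w3 cases]]] := hesse_linearP n2 a31 D0 (lin _ _ _ _ _ _ _ _ _ e1)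
  (lin _ _ _ _ _ _ _ _ _ e2) (lin _ _ _ _ _ _ _ _ _ e3).
exists p, w; split=> //.
have red0 (b : K) (u v v' : A) : b%:MP * u + 0%:MP * v + 0%:MP * v' = b *: u.
  by rewrite -mul_mpolyC mpolyC0; ring.
have red1 (b : K) (u v v' : A) : 0%:MP * v + b%:MP * u + 0%:MP * v' = b *: u.
  by rewrite -mul_mpolyC mpolyC0; ring.
have red2 (b : K) (u v v' : A) : 0%:MP * v + 0%:MP * v' + b%:MP * u = b *: u.
  by rewrite -mul_mpolyC mpolyC0; ring.
case: cases => -[-> -> -> -> -> -> -> -> ->].
- by exists [tuple x; y; z]; [left | split; rewrite ?red0 ?red1 ?red2].
- by exists [tuple y; z; x]; [right; left | split; rewrite ?red0 ?red1 ?red2].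
- by exists [tuple z; x; y]; [right; right | split; rewrite ?red0 ?red1 ?red2].
Qed.
End Images.

(** * Words in generators and their inverses *)

Section Words.
Variables (X : Type) (R : word X -> word X -> Prop).
Local Notation "u ~~> v" := (presented_eq R u v) (at level 70).
Implicit Types u v w : word X.

Lemma presented_catr w u v : u ~~> v -> u ++ w ~~> v ++ w.
Proof. by move=> uv; apply: PresCat uv (PresRefl _ _). Qed.

Lemma presented_catl w u v : u ~~> v -> w ++ u ~~> w ++ v.
Proof. exact: PresCat (PresRefl _ _). Qed.

Lemma presented_inv x u : (false, x) :: u ~~> [::] -> [:: (true, x)] ~~> u.
Proof.
move=> xu; apply: PresTrans (PresSym (presented_catl [:: (true, x)] xu)) _.
exact: (presented_catr u (PresCancel R (true, x))).
Qed.

Lemma eval_word_cat (G : groupType) (f : X -> G) u v :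
  eval_word f (u ++ v) = (eval_word f u * eval_word f v)%g.
Proof. exact: big_cat. Qed.

Lemma eval_word_cons (G : groupType) (f : X -> G) x u :
  eval_word f ((false, x) :: u) = (f x * eval_word f u)%g.
Proof. exact: big_cons. Qed.

Lemma eval_word_nil (G : groupType) (f : X -> G) : eval_word f [::] = 1%g.
Proof. exact: big_nil. Qed.

Lemma eval_word_nseq (G : groupType) (f : X -> G) n x :
  eval_word f (nseq n (false, x)) = (f x ^+ n)%g.
Proof.
elim: n => [|n IH]; first exact: eval_word_nil.
by rewrite expgS -IH; apply: eval_word_cons.
Qed.

Lemma presented_sound (G : groupType) (f : X -> G) :
  (forall u v, R u v -> eval_word f u = eval_word f v) ->
  forall u v, u ~~> v -> eval_word f u = eval_word f v.
Proof.
move=> sound u v; elim=> {u v} [//|//|u v w _ -> _ ->//|u u' v v' _ eu _ ev|[b x]|//].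
  by rewrite !eval_word_cat eu ev.
rewrite /eval_word !big_cons big_nil /= mulg1.
by case: b => /=; rewrite ?mulgV ?mulVg.
Qed.
End Words.

(** * Normal forms of words *)

Section Presentation.
Variables (K : fieldType) (eps : K) (heps : eps ^+ 2 + eps + 1 = 0) (alpha : K).
Local Notation A := {mpoly K[3]}.
Local Notation E := (elliptic alpha).
Local Notation "u ~~> v" := (presented_eq (ell_rel heps) u v) (at level 70).
Local Notation eval := (eval_word (ell_gen_aut alpha heps)).
Local Notation phi g := (false, Phi g).
Local Notation sigma := (false, @Sigma K).
Local Notation tau := (false, @Tau K).
Implicit Types (g h : Kunit K) (i j : nat) (k : 'I_3).

Definition normal_word g j i : word (ell_gen K) :=
  phi g :: nseq j tau ++ nseq i sigma.

Definition Kunit1 : Kunit K := exist _ 1 (oner_neq0 K).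

(** [phi_1] is idempotent by the first relation, and idempotents of a group are
    trivial. *)
Lemma phi1_nil : [:: phi Kunit1] ~~> [::].
Proof.
have e : Kunit_mul Kunit1 Kunit1 = Kunit1 by apply: val_inj; rewrite /= mulr1.
have pp : [:: phi Kunit1; phi Kunit1] ~~> [:: phi Kunit1].
  by rewrite -[X in _ ~~> [:: phi X]]e; apply/PresRel/RelPhiPhi.
have canc := PresCancel (ell_rel heps) (phi Kunit1).
apply: PresTrans (PresSym (presented_catl [:: phi Kunit1] canc)) _.
apply: PresTrans (presented_catr [:: (true, Phi Kunit1)] pp) _.
exact: canc.
Qed.

(** Each exchange of [sigma] and [tau] releases a [phi_eps], which commutes with
    everything. *)
Lemma sigma_tauX j : exists h,
  sigma :: nseq j tau ~~> phi h :: nseq j tau ++ [:: sigma].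
Proof.
elim: j => [|j [h IH]].
  by exists Kunit1; apply: (presented_catr [:: sigma] (PresSym phi1_nil)).
exists (Kunit_mul (Kunit_eps heps) h).
have st : [:: sigma; tau] ~~> [:: phi (Kunit_eps heps); tau; sigma].
  exact/PresRel/RelSigmaTau.
apply: PresTrans (presented_catr (nseq j tau) st) _.
apply: PresTrans (presented_catl [:: phi (Kunit_eps heps); tau] IH) _.
set w := nseq j tau ++ [:: sigma].
have tp : [:: tau; phi h] ~~> [:: phi h; tau] by apply/PresRel/RelTauPhi.
apply: PresTrans (presented_catl [:: phi (Kunit_eps heps)] (presented_catr w tp)) _.
have pp : [:: phi (Kunit_eps heps); phi h] ~~> [:: phi (Kunit_mul (Kunit_eps heps) h)].
  exact/PresRel/RelPhiPhi.
exact: (presented_catr (tau :: w) pp).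
Qed.

Lemma phi_normal h g j i : phi h :: normal_word g j i ~~> normal_word (Kunit_mul h g) j i.
Proof.
exact: (presented_catr _ (PresRel (RelPhiPhi heps h g))).
Qed.

Lemma tau_normal g j i : tau :: normal_word g j i ~~> normal_word g j.+1 i.
Proof. exact: (presented_catr _ (PresRel (RelTauPhi heps g))). Qed.

Lemma sigma_normal g j i : exists h,
  sigma :: normal_word g j i ~~> normal_word h j i.+1.
Proof.
have [h st] := sigma_tauX j; exists (Kunit_mul g h).
apply: PresTrans (presented_catr _ (PresRel (RelSigmaPhi heps g))) _.
apply: PresTrans (presented_catl [:: phi g] (presented_catr (nseq i sigma) st)) _.
rewrite /= -catA; exact: (phi_normal g h j i.+1).
Qed.

Definition Kunit_inv g : Kunit K := exist _ (val g)^-1 (invr_neq0 (valP g)).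

(** The generators have inverses that are products of generators, so positive
    words suffice. *)
Lemma inv_positive (x : ell_gen K) : exists s, [:: (true, x)] ~~> ell_word s.
Proof.
case: x => [g||].
- exists [:: Phi (Kunit_inv g)]; apply: presented_inv.
  apply: PresTrans phi1_nil.
  rewrite (_ : Kunit1 = Kunit_mul g (Kunit_inv g)); first exact/PresRel/RelPhiPhi.
  by apply: val_inj; rewrite /= mulfV ?(valP g).
- by exists [:: Sigma K; Sigma K]; apply: presented_inv; apply/PresRel/RelSigma3.
- by exists [:: Tau K; Tau K]; apply: presented_inv; apply/PresRel/RelTau3.
Qed.

Lemma positive_normal s g j i : exists g' j' i',
  ell_word s ++ normal_word g j i ~~> normal_word g' j' i'.
Proof.
elim: s => [|x s [g' [j' [i' IH]]]]; first by exists g, j, i; apply: PresRefl.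
have IHx := presented_catl [:: (false, x)] IH.
case: x IHx => [h||] IHx.
- exists (Kunit_mul h g'), j', i'; exact: PresTrans IHx (phi_normal _ _ _ _).
- have [h sn] := sigma_normal g' j' i'; exists h, j', i'.+1; exact: PresTrans IHx sn.
- exists g', j'.+1, i'; exact: PresTrans IHx (tau_normal _ _ _).
Qed.

Lemma word_normal w : exists g j i, w ~~> normal_word g j i.
Proof.
elim: w => [|[b x] w [g [j [i IH]]]].
  by exists Kunit1, 0%N, 0%N; apply: PresSym; apply: phi1_nil.
have [s xs] : exists s, [:: (b, x)] ~~> ell_word s.
  by case: b; [apply: inv_positive | exists [:: x]; apply: PresRefl].
have [g' [j' [i' n]]] := positive_normal s g j i.
by exists g', j', i'; apply: PresTrans n; apply: (PresCat xs IH).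
Qed.

Lemma nseq_mod3 l j : nseq 3 l ~~> [::] -> nseq j l ~~> nseq (j %% 3) l.
Proof.
move=> l3; rewrite {1}(divn_eq j 3) nseqD; apply: (presented_catr _ (v := [::])).
elim: (j %/ 3)%N => [|q IH]; first exact: PresRefl.
rewrite mulSn nseqD; exact: PresCat l3 IH.
Qed.

Lemma normal_mod3 g j i : normal_word g j i ~~> normal_word g (j %% 3) (i %% 3).
Proof.
apply: (presented_catl [:: phi g]); apply: PresCat; apply: nseq_mod3.
  exact/PresRel/RelTau3.
exact/PresRel/RelSigma3.
Qed.

(** * The automorphisms given by normal forms *)

Lemma paut_mulE (f1 f2 : pAut E) u : (f1 * f2)%g u = f1 (f2 u).
Proof. by []. Qed.

Lemma phiX g k : ell_phi alpha g ('X_k : A) = val g *: ('X_k : E).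
Proof. by rewrite [LHS]ell_substU; move: k; apply: ord3_case. Qed.

Lemma tauX k : ell_tau alpha ('X_k : A) = ('X_(k + 1) : E).
Proof.
rewrite [LHS]ell_substU; move: k; apply: ord3_case => /=;
  by congr mpolyX; congr mnm1; apply: val_inj.
Qed.

Lemma sigmaX k : ell_sigma alpha heps ('X_k : A) = eps ^+ k *: ('X_k : E).
Proof.
by rewrite [LHS]ell_substU; move: k; apply: ord3_case; rewrite /= ?expr0 ?scale1r.
Qed.

Lemma eval_normal g j i k :
  eval (normal_word g j i) ('X_k : A) = (val g * eps ^+ (i * k)) *: ('X_(k + j%:R) : E).
Proof.
have sX : (ell_sigma alpha heps ^+ i)%g ('X_k : A) = eps ^+ (i * k) *: ('X_k : E).
  elim: i => [|i IH]; first by rewrite expr0 scale1r.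
  by rewrite expgS paut_mulE IH pautZ sigmaX scalerA -exprD -mulSnr.
have tX k' : (ell_tau alpha ^+ j)%g ('X_k' : A) = ('X_(k' + j%:R) : E).
  elim: j => [|j' IH]; first by rewrite addr0.
  by rewrite expgS paut_mulE IH tauX -addrA -natr1.
rewrite /normal_word eval_word_cons eval_word_cat !eval_word_nseq 2!paut_mulE.
by rewrite sX !pautZ tX phiX scalerA mulrC.
Qed.

Lemma rel_sound u v : ell_rel heps u v -> eval u = eval v.
Proof.
have s3 k : (eps ^+ k) ^+ 3 = 1 by rewrite -exprM mulnC exprM eps3 // expr1n.
case=> [g h|g|g|||]; apply: paut_gen_eq => k;
  rewrite /ell_word /= !eval_word_cons !eval_word_nil ?mulg1 ?paut_mulE.
- by rewrite !phiX pautZ phiX scalerA mulrC.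
- by rewrite phiX pautZ !sigmaX pautZ phiX !scalerA mulrC.
- by rewrite phiX pautZ !tauX phiX.
- rewrite !(sigmaX, pautZ) !scalerA.
  by rewrite [_ * _ in LHS](_ : _ = 1) ?scale1r // -(s3 k) !exprS expr0 mulr1 mulrA.
- rewrite !tauX -!addrA; congr mpolyX; congr mnm1; apply: val_inj.
  by move: k; apply: ord3_case.
rewrite tauX !sigmaX !pautZ tauX phiX scalerA -exprSr; congr (_ *: _).
by move: k; apply: ord3_case => //=; rewrite eps3.
Qed.

Lemma eps_neq1 : 3%:R != 0 :> K -> eps != 1.
Proof.
move=> n3; apply: contraNneq n3 => e; move: heps; rewrite e => <-.
by apply/eqP; ring.
Qed.

Lemma expr_eps_mod3 i i' : 3%:R != 0 :> K ->
  eps ^+ i = eps ^+ i' -> i = i' %[mod 3].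
Proof.
move=> n3 /eqP e; apply/eqP; move: e.
rewrite (@eq_prim_root_expr _ 3) //.
have e1 := eps_neq1 n3.
have [m pm m3] := @prim_order_exists _ 3 eps isT (eps3 heps).
have : (m == 1%N) || (m == 3%N) by move: m3 (primeP (isT : prime 3)) => m3 [_]; apply.
case/orP => /eqP me; rewrite me // in pm.
by move/prim_expr_order: pm; rewrite expr1 => /eqP; rewrite (negPf e1).
Qed.

Lemma scaleX_inj (b b' : K) k k' : b != 0 ->
  b *: ('X_k : A) = b' *: 'X_k' -> b = b' /\ k = k'.
Proof.
move=> b0 /(congr1 (mcoeff U_(k))); rewrite !mcoeffZ !mcoeffXU eqxx mulr1 [k' == k]eq_sym.
have [->|ne] := eqVneq k k'; first by rewrite mulr1.
by rewrite mulr0 => b00; rewrite b00 eqxx in b0.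
Qed.

(** The image of [x] gives [g] and [j], and then the image of [y] gives [eps^i]. *)
Lemma eval_normal_inj g j i g' j' i' : 3%:R != 0 :> K ->
  eval (normal_word g j i) = eval (normal_word g' j' i') ->
  [/\ g = g', j = j' %[mod 3] & i = i' %[mod 3]].
Proof.
move=> n3 e.
have e0 := congr1 (fun p : pAut E => p ('X_0 : A)) e.
have e1 := congr1 (fun p : pAut E => p ('X_1 : A)) e.
rewrite /= !eval_normal !muln0 !mulr1 !add0r in e0.
have [gE jE] := scaleX_inj (valP g) e0.
have gg : g = g' by apply: val_inj.
rewrite /= !eval_normal gE !muln1 in e1.
have nz : val g' * eps ^+ i != 0.
  by rewrite mulf_neq0 ?(valP g') // expf_neq0 // (eps_neq0 heps).
have [/(mulfI (valP g')) iE _] := scaleX_inj nz e1.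
split=> //; last exact: expr_eps_mod3 iE.
have valE n : val (n%:R : 'I_3) = (n %% 3)%N := @val_Zp_nat 3 isT n.
by move/(congr1 val): jE; rewrite !valE.
Qed.

(** In [paut_images] the cube root of unity is a power of [eps] because
    [w^3 - 1 = (w - 1) (w - eps) (w - eps^2)], and the cyclic permutation is a
    power of [tau]. *)
Lemma eval_normal_surj (f : pAut E) : [pchar K] =i pred0 -> alpha ^+ 3 != 1 ->
  exists g j i, eval (normal_word g j i) = f.
Proof.
move=> char0 a31.
have n3 : 3%:R != 0 :> K by move/pcharf0P: char0 => ->.
have [p [w [p0 w3 [t tE [fx fy fz]]]]] := paut_images f char0 a31.
have [i wE] : exists i, w = eps ^+ i.
  have : (w - 1) * (w - eps) * (w - eps ^+ 2) = 0.
    transitivity (w ^+ 3 - eps ^+ 3 - (eps ^+ 2 + eps + 1) * (w ^+ 2 - eps * w)).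
      by ring.
    by rewrite heps w3 eps3 // subrr mul0r subr0.
  move/eqP; rewrite !mulf_eq0 -orbA !subr_eq0 => /or3P[] /eqP->.
  - by exists 0%N; rewrite expr0.
  - by exists 1%N; rewrite expr1.
  - by exists 2%N.
have tX : exists j, forall k : 'I_3, t`_k = 'X_(k + j%:R).
  case: tE => [->|[->|->]]; [exists 0%N | exists 1%N | exists 2%N];
    apply: ord3_case => /=; congr mpolyX; congr mnm1; exact: val_inj.
case: tX => j tX; exists (exist _ p p0 : Kunit K), j, i.
apply: paut_gen_eq => k; rewrite eval_normal -tX /=.
move: k; apply: ord3_case => /=.
- by rewrite muln0 mulr1 fx.
- by rewrite muln1 fy wE.
- by rewrite exprM fz wE.
Qed.

End Presentation.

Theorem corollary2 (K : fieldType) (char0 : [pchar K] =i pred0)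
    (eps : K) (heps : eps ^+ 2 + eps + 1 = 0)
    (alpha : K) (halpha : alpha ^+ 3 != 1) :
  defining_relations (G := pAut (elliptic alpha))
    (ell_gen_aut alpha heps) (ell_rel heps).
Proof.
have n3 : 3%:R != 0 :> K by move/pcharf0P: char0 => ->.
split=> [f|u v].
  by have [g [j [i <-]]] := eval_normal_surj heps f char0 halpha; eexists.
have sound := presented_sound (@rel_sound _ _ heps alpha).
split=> [e|]; last exact: sound.
have [g [j [i nu]]] := word_normal heps u.
have [g' [j' [i' nv]]] := word_normal heps v.
have en : eval_word (ell_gen_aut alpha heps) (normal_word g j i) =
    eval_word (ell_gen_aut alpha heps) (normal_word g' j' i').
  by rewrite -(sound _ _ nu) -(sound _ _ nv).
have [gE jE iE] := eval_normal_inj n3 en; rewrite gE in nu.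
apply: PresTrans nu _; apply: PresTrans (PresSym nv).
apply: PresTrans (normal_mod3 heps _ _ _) _; rewrite jE iE.
exact: PresSym (normal_mod3 heps _ _ _).
Qed.
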